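(* Let $f(x,y)$ and $g(x,y,z)$ be real-valued functions of positive real variables, homogeneous of the same degree $n$. Suppose that $f(R,r)\geq g(a,b,c)$ holds for all Euclidean triangles with side lengths $a,b,c$, circumradius $R$ and inradius $r$, with equality if and only if $a=b=c$. Then: (a) if, for every $M>0$, $f\left(\frac{2M^2}{x},x\right)$ is a decreasing function of $x$ for $0<x\leq M$, then $$f(\tan R,\tan r)\geq 2^n\cdot g\left(\sin\tfrac a2,\sin\tfrac b2,\sin\tfrac c2\right)\cdot\left(\frac{\sin\frac a2+\sin\frac b2+\sin\frac c2}{\sin\frac{a+b+c}{2}}\right)^{n/2}$$ holds for all spherical triangles with side lengths $a,b,c$, circumradius $R$ and inradius $r$, with equality if and only if $a=b=c$; (b) if, for every $M>0$, $f\left(\frac{2M^2}{x},x\right)$ is an increasing function of $x$ for $0<x\leq M$, then $$f(\tanh R,\tanh r)\geq 2^n\cdot g\left(\sinh\tfrac a2,\sinh\tfrac b2,\sinh\tfrac c2\right)\cdot\left(\frac{\sinh\frac a2+\sinh\frac b2+\sinh\frac c2}{\sinh\frac{a+b+c}{2}}\right)^{n/2}$$ holds for all hyperbolic triangles with side lengths $a,b,c$, circumradius $R$ and inradius $r$, with equality if and only if $a=b=c$.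
   Context: Homogeneous of degree $n$ means $f(tx,ty)=t^nf(x,y)$ and $g(tx,ty,tz)=t^ng(x,y,z)$ for all $t>0$. ''Decreasing'' and ''increasing'' are meant in the weak sense (nonincreasing, nondecreasing). Triangles are nondegenerate. Spherical geometry is the geometry of the unit sphere in $\mathbb{R}^3$ (curvature $1$); a spherical triangle has three vertices not lying on a common great circle, joined by minor great-circle arcs. Hyperbolic geometry is the geometry of the hyperbolic plane of curvature $-1$. Side lengths are geodesic lengths. The circumradius $R$ is the radius (in the intrinsic metric; $R<\pi/2$ in the spherical case) of the circle through the three vertices, and the inradius $r$ is the radius of the inscribed circle. Hyperbolic triangles are understood to have a circumscribed circle, so that $R$ is defined. *)

(* Defs.v *)
From Stdlib Require Export Reals.
Open Scope R_scope.

(** * Circumscribed and inscribed circles, for any of the three geometries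

    [space] is the set of points of the geometry inside an ambient type [T],
    [dist] its intrinsic distance, [segment A B] the closed geodesic segment
    [AB], [interior A B C] the open triangle [ABC]. *)

Definition circumscribed_circle {T : Type} (dist : T -> T -> R)
    (A B C O : T) (rho : R) : Prop :=
  dist O A = rho /\ dist O B = rho /\ dist O C = rho.

(* The circle meets the segment, and no point of the segment is inside it. *)
Definition touches {T : Type} (dist : T -> T -> R)
    (segment : T -> T -> T -> Prop) (I : T) (rho : R) (A B : T) : Prop :=
  (exists P, segment A B P /\ dist I P = rho) /\
  (forall P, segment A B P -> rho <= dist I P).

Definition inscribed_circle {T : Type} (dist : T -> T -> R)
    (segment : T -> T -> T -> Prop) (interior : T -> T -> T -> T -> Prop)
    (A B C I : T) (rho : R) : Prop :=
  interior A B C I /\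
  touches dist segment I rho A B /\
  touches dist segment I rho B C /\
  touches dist segment I rho C A.

(** * The Euclidean plane *)

Definition plane : Type := (R * R)%type.

Definition plane_dist (P Q : plane) : R :=
  dist_euc (fst P) (snd P) (fst Q) (snd Q).

Definition plane_segment (A B P : plane) : Prop :=
  exists s t : R, 0 <= s /\ 0 <= t /\ s + t = 1 /\
    P = (s * fst A + t * fst B, s * snd A + t * snd B).

Definition plane_interior (A B C P : plane) : Prop :=
  exists s t u : R, 0 < s /\ 0 < t /\ 0 < u /\ s + t + u = 1 /\
    P = (s * fst A + t * fst B + u * fst C,
         s * snd A + t * snd B + u * snd C).

Definition on_line (p q c : R) (P : plane) : Prop :=
  p * fst P + q * snd P = c.

Definition plane_nondegenerate (A B C : plane) : Prop :=
  ~ exists p q c : R, (p <> 0 \/ q <> 0) /\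
      on_line p q c A /\ on_line p q c B /\ on_line p q c C.

(* There is a Euclidean triangle with side lengths [a], [b], [c],
   circumradius [Rad] and inradius [r]. *)
Definition euclidean_triangle (a b c Rad r : R) : Prop :=
  exists A B C : plane,
    plane_nondegenerate A B C /\
    a = plane_dist B C /\ b = plane_dist C A /\ c = plane_dist A B /\
    (exists O, circumscribed_circle plane_dist A B C O Rad) /\
    (exists I, inscribed_circle plane_dist plane_segment plane_interior
                 A B C I r).

(** * Vectors of R^3 *)

Definition vec3 : Type := (R * R * R)%type.

Definition zero3 : vec3 := (0, 0, 0).

Definition add3 (u v : vec3) : vec3 :=
  let '(u1, u2, u3) := u in
  let '(v1, v2, v3) := v in (u1 + v1, u2 + v2, u3 + v3).

Definition scale3 (t : R) (u : vec3) : vec3 :=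
  let '(u1, u2, u3) := u in (t * u1, t * u2, t * u3).

Definition dot (u v : vec3) : R :=
  let '(u1, u2, u3) := u in
  let '(v1, v2, v3) := v in u1 * v1 + u2 * v2 + u3 * v3.

Definition lorentz (u v : vec3) : R :=
  let '(u1, u2, u3) := u in
  let '(v1, v2, v3) := v in u1 * v1 + u2 * v2 - u3 * v3.

(* On the unit sphere and on the hyperboloid, geodesics are the intersections
   with planes through the origin. Hence the geodesic segment (the minor arc,
   on the sphere) and the triangle spanned by linearly independent points are
   cut out by the cones that these points span. *)

Definition cone_segment (space : vec3 -> Prop) (A B P : vec3) : Prop :=
  space P /\
  exists s t : R, 0 <= s /\ 0 <= t /\ P = add3 (scale3 s A) (scale3 t B).

Definition cone_interior (space : vec3 -> Prop) (A B C P : vec3) : Prop :=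
  space P /\
  exists s t u : R, 0 < s /\ 0 < t /\ 0 < u /\
    P = add3 (add3 (scale3 s A) (scale3 t B)) (scale3 u C).

(* No common great circle, respectively no common hyperbolic line. *)
Definition no_common_geodesic (A B C : vec3) : Prop :=
  ~ exists u : vec3, u <> zero3 /\ dot u A = 0 /\ dot u B = 0 /\ dot u C = 0.

(** * The unit sphere *)

Definition sphere (P : vec3) : Prop := dot P P = 1.

Definition sphere_dist (P Q : vec3) : R := acos (dot P Q).

(* The bound on [Rad] selects one of the two antipodal centers of the circle
   through the vertices. *)
Definition spherical_triangle (a b c Rad r : R) : Prop :=
  exists A B C : vec3,
    sphere A /\ sphere B /\ sphere C /\ no_common_geodesic A B C /\
    a = sphere_dist B C /\ b = sphere_dist C A /\ c = sphere_dist A B /\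
    (Rad < PI / 2 /\
     exists O, sphere O /\ circumscribed_circle sphere_dist A B C O Rad) /\
    (exists I, inscribed_circle sphere_dist (cone_segment sphere)
                 (cone_interior sphere) A B C I r).

(** * The hyperbolic plane (hyperboloid model) *)

Definition hyperboloid (P : vec3) : Prop :=
  lorentz P P = -1 /\ 0 < snd P.

(* The inverse of [cosh] on nonnegative reals. *)
Definition arcosh (x : R) : R := ln (x + sqrt (x ^ 2 - 1)).

Definition hyperboloid_dist (P Q : vec3) : R := arcosh (- lorentz P Q).

Definition hyperbolic_triangle (a b c Rad r : R) : Prop :=
  exists A B C : vec3,
    hyperboloid A /\ hyperboloid B /\ hyperboloid C /\
    no_common_geodesic A B C /\
    a = hyperboloid_dist B C /\ b = hyperboloid_dist C A /\
    c = hyperboloid_dist A B /\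
    (exists O, hyperboloid O /\
       circumscribed_circle hyperboloid_dist A B C O Rad) /\
    (exists I, inscribed_circle hyperboloid_dist (cone_segment hyperboloid)
                 (cone_interior hyperboloid) A B C I r).

(** * Conditions on [f] and [g] *)

(* [n] is an arbitrary real degree. *)
Definition homogeneous2 (n : R) (f : R -> R -> R) : Prop :=
  forall t x y : R, 0 < t -> 0 < x -> 0 < y ->
    f (t * x) (t * y) = Rpower t n * f x y.

Definition homogeneous3 (n : R) (g : R -> R -> R -> R) : Prop :=
  forall t x y z : R, 0 < t -> 0 < x -> 0 < y -> 0 < z ->
    g (t * x) (t * y) (t * z) = Rpower t n * g x y z.

Definition decreasing_upto (M : R) (h : R -> R) : Prop :=
  forall x y : R, 0 < x -> x <= y -> y <= M -> h y <= h x.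

Definition increasing_upto (M : R) (h : R -> R) : Prop :=
  forall x y : R, 0 < x -> x <= y -> y <= M -> h x <= h y.

(* Main.v *)
Require Import Defs.
From Stdlib Require Import Reals Lra Psatz.
Open Scope R_scope.

(** Why the theorem holds.  Put e = 1 on the sphere and e = -1 in the hyperbolic
    plane, and let x, y, z be the (hyperbolic) sines of the half sides, X, Y, Z
    their (hyperbolic) cosines, kap and k the (hyperbolic) cosine and sine of the
    circumradius, and sn the (hyperbolic) sine of the half perimeter.  Write H for
    Heron's product of x, y, z, that is 16 times the squared area of a Euclidean
    triangle with sides x, y, z.

    On the sphere, 2x, 2y, 2z are the chords of the sides, and the vertices lie
    on a Euclidean circle of radius k; the resulting relation
    k^2 H = 4 (x y z)^2 persists in the hyperbolic plane
    ([gram_circumcenter]).  This relation and the perpendiculars from the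
    incenter to the sides give
         tan R = 2 x y z / (kap sqrt H),   tan r = kap sqrt H / sn
    (tanh in the hyperbolic plane; [curved_radii]).  In particular
    tan R tan r = 2 x y z / sn.

    Homogeneity turns the right-hand side of the claim into g of the sides of the
    Euclidean triangle with sides lam x, lam y, lam z, where
    lam^2 = 4 (x + y + z) / sn.  This factor lam is the one for which the
    Euclidean radii R', r' satisfy R' r' = tan R tan r.  Hence both pairs of radii
    lie on one curve (2 M^2 / t, t), and by the monotonicity assumption on f it
    remains to compare r' and tan r, both at most M.  On the sphere
    tan r <= r', in the hyperbolic plane tanh r >= r'; both say that
    e (sn - kap^2 (x + y + z)) >= 0, which is the Cauchy-Schwarz inequality
    (reversed for the Lorentz form) applied to each term of the addition formula for sn
    ([half_perimeter_sine_comparison]).  That the larger of the two inradii is at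
    most M is Euler's inequality: the Euclidean one on the sphere ([heron_le]),
    the hyperbolic one otherwise ([hyperbolic_euler]).

    Equality forces equality in the Euclidean inequality, hence x = y = z and
    a = b = c.  Conversely for equilateral triangles the Cauchy-Schwarz step is an
    equality, so the two pairs of radii coincide. *)

(** * Euclidean triangles with given sides *)

Lemma plane_dist_eq (P Q : plane) (d : R) :
  0 <= d ->
  (fst P - fst Q) ^ 2 + (snd P - snd Q) ^ 2 = d ^ 2 -> plane_dist P Q = d.
Proof.
  intros Hd H. unfold plane_dist, dist_euc, Rsqr.
  replace (_ + _) with (d ^ 2) by (rewrite <- H; ring).
  now rewrite sqrt_pow2.
Qed.

(** By Pythagoras, the foot of a perpendicular is the nearest point of the whole
    line, so exhibiting the foot on the segment proves tangency. *)
Lemma touches_of_perpendicular_foot (A B I P : plane) (rho : R) :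
  plane_segment A B P -> plane_dist I P = rho ->
  (fst I - fst P) * (fst B - fst A) + (snd I - snd P) * (snd B - snd A) = 0 ->
  touches plane_dist plane_segment I rho A B.
Proof.
  intros HP Hd Hperp. split; [now exists P |].
  intros Q (s & t & Hs & Ht & Hst & ->).
  destruct HP as (s' & t' & Hs' & Ht' & Hst' & ->).
  rewrite <- Hd. unfold plane_dist, dist_euc, Rsqr. simpl in *.
  apply sqrt_le_1_alt.
  set (dx := fst B - fst A) in *. set (dy := snd B - snd A) in *.
  replace (s * fst A + t * fst B) with (fst A + t * dx)
    by (unfold dx; replace s with (1 - t) by lra; ring).
  replace (s * snd A + t * snd B) with (snd A + t * dy)
    by (unfold dy; replace s with (1 - t) by lra; ring).
  replace (s' * fst A + t' * fst B) with (fst A + t' * dx) in *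
    by (unfold dx; replace s' with (1 - t') by lra; ring).
  replace (s' * snd A + t' * snd B) with (snd A + t' * dy) in *
    by (unfold dy; replace s' with (1 - t') by lra; ring).
  pose proof (Rle_0_sqr ((t - t') * dx)). pose proof (Rle_0_sqr ((t - t') * dy)).
  unfold Rsqr in *.
  set (px := fst I - (fst A + t' * dx)) in *.
  set (py := snd I - (snd A + t' * dy)) in *.
  replace (fst I - (fst A + t * dx)) with (px - (t - t') * dx) by (unfold px; ring).
  replace (snd I - (snd A + t * dy)) with (py - (t - t') * dy) by (unfold py; ring).
  nra.
Qed.

(** With the incenter on the vertical axis and the side [BC] on the horizontal one,
    touched at the origin at distances [v], [w] from its ends, all coordinates
    are rational functions of [v], [w], [r]: the tangents of the half angles at
    [B] and [C] are [r / v] and [r / w].  The angles at [B] and [C] leave room for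
    a third one exactly when [r ^ 2 < v * w]. *)
Lemma euclidean_triangle_of_incircle (v w r : R) :
  0 < v -> 0 < w -> 0 < r -> r ^ 2 < v * w ->
  euclidean_triangle (v + w)
    (v * (r ^ 2 + w ^ 2) / (v * w - r ^ 2))
    (w * (r ^ 2 + v ^ 2) / (v * w - r ^ 2))
    ((r ^ 2 + v ^ 2) * (r ^ 2 + w ^ 2) / (4 * r * (v * w - r ^ 2))) r.
Proof.
  intros Hv Hw Hr Hvw.
  set (q := v * w - r ^ 2). assert (Hq : 0 < q) by (unfold q; lra).
  assert (Hvw0 : 0 < v * w) by nra.
  assert (Hr2 : 0 < r ^ 2) by nra.
  assert (Hqv : 0 < r ^ 2 + v ^ 2) by nra.
  assert (Hqw : 0 < r ^ 2 + w ^ 2) by nra.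
  pose (A := (r ^ 2 * (v - w) / q, 2 * r * v * w / q) : plane).
  pose (B := (- v, 0) : plane). pose (C := (w, 0) : plane).
  pose (I := (0, r) : plane).
  pose (O := ((w - v) / 2, ((r * (v + w)) ^ 2 - q ^ 2) / (4 * r * q)) : plane).
  assert (Hside : forall x y d, 0 < x -> 0 < y -> 0 < d -> 0 < x * y / d).
  { intros x y d Hx Hy Hd. apply Rdiv_lt_0_compat; nra. }
  assert (HR : 0 < (r ^ 2 + v ^ 2) * (r ^ 2 + w ^ 2) / (4 * r * q)).
  { apply Hside; nra. }
  exists A, B, C. repeat split.
  - intros (l1 & l2 & l3 & Hn & HA & HB & HC).
    unfold on_line, A, B, C in *. simpl in *.
    assert (l1 = 0) by nra. assert (l3 = 0) by nra. subst.
    assert (Hh : 0 < 2 * r * v * w / q) by (apply Rdiv_lt_0_compat; nra).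
    assert (l2 = 0) by nra. lra.
  - symmetry. apply plane_dist_eq; [lra |]. unfold B, C. simpl. ring.
  - symmetry. apply plane_dist_eq; [left; now apply Hside |].
    unfold A, C. simpl. unfold q in *. field. lra.
  - symmetry. apply plane_dist_eq; [left; now apply Hside |].
    unfold A, B. simpl. unfold q in *. field. lra.
  - exists O. repeat split; (apply plane_dist_eq; [lra |]);
      unfold O, A, B, C; simpl; unfold q in *; field; lra.
  - exists I. split; [| split; [| split]].
    + exists (q / (2 * v * w)), ((r ^ 2 + w ^ 2) / (2 * w * (v + w))),
        ((r ^ 2 + v ^ 2) / (2 * v * (v + w))).
      repeat split; try (apply Rdiv_lt_0_compat; nra).
      * unfold q. field. lra.
      * unfold I, A, B, C. simpl. unfold q in *.
        f_equal; field; lra.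
    (* The tangent segments from [A] have length [r ^ 2 * (v + w) / q], which gives
       the barycentric coordinates of the other two points of contact. *)
    + set (s := v * q / (w * (r ^ 2 + v ^ 2))).
      set (t := r ^ 2 * (v + w) / (w * (r ^ 2 + v ^ 2))).
      apply touches_of_perpendicular_foot
        with (P := (s * fst A + t * fst B, s * snd A + t * snd B)).
      * exists s, t. repeat split.
        -- left. apply Rdiv_lt_0_compat; nra.
        -- left. apply Rdiv_lt_0_compat; nra.
        -- unfold s, t, q. field. nra.
      * apply plane_dist_eq; [lra |].
        unfold I, A, B, s, t; simpl; unfold q in *; field; repeat split; nra.
      * unfold I, A, B, s, t; simpl; unfold q in *; field; repeat split; nra.
    + apply touches_of_perpendicular_foot with (P := (0, 0)).
      * exists (w / (v + w)), (v / (v + w)). repeat split.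
        -- left. apply Rdiv_lt_0_compat; nra.
        -- left. apply Rdiv_lt_0_compat; nra.
        -- field. lra.
        -- unfold B, C. simpl. f_equal; field; lra.
      * apply plane_dist_eq; [lra |]. unfold I. simpl. ring.
      * unfold I, B, C. simpl. ring.
    + set (s := r ^ 2 * (v + w) / (v * (r ^ 2 + w ^ 2))).
      set (t := w * q / (v * (r ^ 2 + w ^ 2))).
      apply touches_of_perpendicular_foot
        with (P := (s * fst C + t * fst A, s * snd C + t * snd A)).
      * exists s, t. repeat split.
        -- left. apply Rdiv_lt_0_compat; nra.
        -- left. apply Rdiv_lt_0_compat; nra.
        -- unfold s, t, q. field. nra.
      * apply plane_dist_eq; [lra |].
        unfold I, A, C, s, t; simpl; unfold q in *; field; repeat split; nra.
      * unfold I, A, C, s, t; simpl; unfold q in *; field; repeat split; nra.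
Qed.

(** Sixteen times the squared area of the triangle with sides [x], [y], [z]. *)
Definition heron (x y z : R) : R :=
  (x + y + z) * (- x + y + z) * (x - y + z) * (x + y - z).

(** Two of the last three factors of [heron] cannot both be nonpositive, since the
    sum of any two is positive; so a positive product makes all three positive. *)
Lemma heron_pos_triangle_ineq (x y z : R) :
  0 < x -> 0 < y -> 0 < z -> 0 < heron x y z ->
  0 < - x + y + z /\ 0 < x - y + z /\ 0 < x + y - z.
Proof.
  unfold heron. intros Hx Hy Hz H.
  assert (H1 : 0 < (- x + y + z) * ((x - y + z) * (x + y - z))) by nra.
  assert (key : forall p q r, 0 < p + q -> 0 < p + r -> 0 < p * (q * r) -> 0 < p).
  { intros p q r Hpq Hpr Hp. destruct (Rlt_or_le 0 p) as [| Hn]; [assumption |].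
    assert (0 < q * r) by (apply Rmult_lt_0_compat; lra). nra. }
  repeat split; [eapply key with (3 := H1) | |]; try lra.
  - apply key with (- x + y + z) (x + y - z); lra.
  - apply key with (- x + y + z) (x - y + z); lra.
Qed.

(** The distances from the vertices to the points of contact are the half perimeter
    minus the opposite sides, which reduces the claim to
    [euclidean_triangle_of_incircle]. *)
Lemma euclidean_triangle_of_sides (x y z : R) :
  0 < x -> 0 < y -> 0 < z -> 0 < heron x y z ->
  euclidean_triangle x y z (x * y * z / sqrt (heron x y z))
    (sqrt (heron x y z) / (2 * (x + y + z))).
Proof.
  intros Hx Hy Hz HH.
  destruct (heron_pos_triangle_ineq x y z Hx Hy Hz HH) as (H1 & H2 & H3).
  set (h := sqrt (heron x y z)).
  assert (Hh : 0 < h) by (now apply sqrt_lt_R0).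
  assert (Hh2 : h ^ 2 = heron x y z) by (apply pow2_sqrt; lra).
  set (v := (x - y + z) / 2). set (w := (x + y - z) / 2).
  set (r := h / (2 * (x + y + z))).
  assert (Hr : 0 < r) by (apply Rdiv_lt_0_compat; lra).
  assert (Hr2 : r ^ 2 = (- x + y + z) / (x + y + z) * (v * w)).
  { unfold r. replace ((h / (2 * (x + y + z))) ^ 2)
      with (h ^ 2 / (4 * (x + y + z) ^ 2)) by (field; lra).
    rewrite Hh2. unfold heron, v, w. field. lra. }
  assert (Hvw : 0 < v * w) by (unfold v, w; nra).
  assert (Hq : v * w - r ^ 2 = 2 * x / (x + y + z) * (v * w)).
  { rewrite Hr2. field. lra. }
  assert (Hq0 : 0 < 2 * x / (x + y + z)) by (apply Rdiv_lt_0_compat; lra).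
  assert (Ex : v + w = x) by (unfold v, w; field).
  assert (Ey : v * (r ^ 2 + w ^ 2) / (v * w - r ^ 2) = y).
  { rewrite Hq, Hr2. unfold v, w. field. lra. }
  assert (Ez : w * (r ^ 2 + v ^ 2) / (v * w - r ^ 2) = z).
  { rewrite Hq, Hr2. unfold v, w. field. lra. }
  assert (ER : (r ^ 2 + v ^ 2) * (r ^ 2 + w ^ 2) / (4 * r * (v * w - r ^ 2))
               = x * y * z / h).
  { rewrite Hq, Hr2. unfold r, v, w. field. lra. }
  rewrite <- ER. rewrite <- Ex at 1. rewrite <- Ey at 1. rewrite <- Ez at 1.
  apply euclidean_triangle_of_incircle; unfold v, w in *; try lra; nra.
Qed.

(** * Trigonometric identities and inequalities common to both geometries *)

(** The addition formula for [sin ((a + b + c) / 2)] when [e = 1], and for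
    [sinh ((a + b + c) / 2)] when [e = -1], in the sines [x], [y], [z] and the
    cosines [X], [Y], [Z] of the half sides. *)
Definition half_perimeter_sine (e x y z X Y Z : R) : R :=
  x * Y * Z + X * y * Z + X * Y * z - e * (x * y * z).

(** For [e = 1], the Cauchy-Schwarz inequality for the vectors [(kap, y)] and
    [(kap, z)], of lengths [Y] and [Z]; for [e = -1], the reversed inequality for
    the Lorentz form. *)
Lemma curved_cauchy (e kap y z Y Z : R) :
  e = 1 \/ e = -1 -> 0 < Y -> 0 < Z ->
  Y ^ 2 = kap ^ 2 + e * y ^ 2 -> Z ^ 2 = kap ^ 2 + e * z ^ 2 ->
  0 <= e * (Y * Z - kap ^ 2) - y * z.
Proof.
  intros He HY HZ EY EZ.
  assert (E : (Y * Z) ^ 2 - (kap ^ 2 + e * (y * z)) ^ 2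
              = e * (kap * (y - z)) ^ 2).
  { replace ((Y * Z) ^ 2) with (Y ^ 2 * Z ^ 2) by ring. rewrite EY, EZ.
    destruct He; subst e; ring. }
  pose proof (pow2_ge_0 (kap * (y - z))) as Hsq.
  assert (HYZ : 0 < Y * Z) by now apply Rmult_lt_0_compat.
  destruct He; subst e.
  - destruct (Rlt_or_le (Y * Z) (kap ^ 2 + 1 * (y * z))); nra.
  - assert (0 < Y ^ 2) by nra. assert (0 < Z ^ 2) by nra.
    pose proof (pow2_ge_0 (y - z)).
    assert (0 <= kap ^ 2 + -1 * (y * z)) by nra.
    destruct (Rlt_or_le (kap ^ 2 + -1 * (y * z)) (Y * Z)); nra.
Qed.

(** By [k ^ 2 * heron x y z = 4 * (x * y * z) ^ 2], the numbers [x], [y], [z] are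
    [k] times the sines of the angles of a Euclidean triangle; let [al], [be],
    [ga] be [k] times their cosines.  Then [X ^ 2 = kap ^ 2 + e * al ^ 2], and
    [curved_cauchy] bounds each product of two cosines in
    [half_perimeter_sine].  What is left over is [k ^ 3] times the sine of the sum of
    the three angles, which is zero: this is [Hsum]. *)
Lemma half_perimeter_sine_comparison (e kap k x y z X Y Z : R) :
  e = 1 \/ e = -1 ->
  0 < x -> 0 < y -> 0 < z -> 0 < X -> 0 < Y -> 0 < Z ->
  X ^ 2 = 1 - e * x ^ 2 -> Y ^ 2 = 1 - e * y ^ 2 -> Z ^ 2 = 1 - e * z ^ 2 ->
  k ^ 2 = e * (1 - kap ^ 2) -> k ^ 2 * heron x y z = 4 * (x * y * z) ^ 2 ->
  0 <= e * (half_perimeter_sine e x y z X Y Z - kap ^ 2 * (x + y + z)).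
Proof.
  intros He Hx Hy Hz HX HY HZ EX EY EZ Hk HH.
  set (al := k * (y ^ 2 + z ^ 2 - x ^ 2) / (2 * y * z)).
  set (be := k * (z ^ 2 + x ^ 2 - y ^ 2) / (2 * z * x)).
  set (ga := k * (x ^ 2 + y ^ 2 - z ^ 2) / (2 * x * y)).
  assert (Ek : forall u, 1 - e * u = kap ^ 2 + e * (k ^ 2 - u)).
  { intros u. rewrite Hk. destruct He; subst e; ring. }
  assert (Hal : al ^ 2 = k ^ 2 - x ^ 2).
  { replace (al ^ 2) with (k ^ 2 - k ^ 2 * heron x y z / (4 * (y * z) ^ 2))
      by (unfold al, heron; field; lra).
    rewrite HH. field. lra. }
  assert (Hbe : be ^ 2 = k ^ 2 - y ^ 2).
  { replace (be ^ 2) with (k ^ 2 - k ^ 2 * heron x y z / (4 * (z * x) ^ 2))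
      by (unfold be, heron; field; lra).
    rewrite HH. field. lra. }
  assert (Hga : ga ^ 2 = k ^ 2 - z ^ 2).
  { replace (ga ^ 2) with (k ^ 2 - k ^ 2 * heron x y z / (4 * (x * y) ^ 2))
      by (unfold ga, heron; field; lra).
    rewrite HH. field. lra. }
  assert (Hsum : x * (be * ga) + y * (al * ga) + z * (al * be) = x * y * z).
  { transitivity (k ^ 2 * heron x y z / (4 * x * y * z)).
    - unfold al, be, ga, heron. field. lra.
    - rewrite HH. field. lra. }
  rewrite Ek, <- Hal in EX. rewrite Ek, <- Hbe in EY. rewrite Ek, <- Hga in EZ.
  pose proof (curved_cauchy e kap be ga Y Z He HY HZ EY EZ) as C1.
  pose proof (curved_cauchy e kap al ga X Z He HX HZ EX EZ) as C2.
  pose proof (curved_cauchy e kap al be X Y He HX HY EX EY) as C3.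
  apply (Rmult_le_pos x) in C1; [| lra].
  apply (Rmult_le_pos y) in C2; [| lra].
  apply (Rmult_le_pos z) in C3; [| lra].
  replace (e * (half_perimeter_sine e x y z X Y Z - kap ^ 2 * (x + y + z)))
    with (x * (e * (Y * Z - kap ^ 2) - be * ga)
          + y * (e * (X * Z - kap ^ 2) - al * ga)
          + z * (e * (X * Y - kap ^ 2) - al * be)
          + (x * (be * ga) + y * (al * ga) + z * (al * be) - x * y * z)).
  - rewrite Hsum. lra.
  - unfold half_perimeter_sine. destruct He; subst e; ring.
Qed.

Lemma half_perimeter_sine_equilateral (e kap k x X : R) :
  e = 1 \/ e = -1 -> 0 < x -> X ^ 2 = 1 - e * x ^ 2 ->
  k ^ 2 = e * (1 - kap ^ 2) -> k ^ 2 * heron x x x = 4 * (x * x * x) ^ 2 ->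
  half_perimeter_sine e x x x X X X = kap ^ 2 * (x + x + x).
Proof.
  intros He Hx EX Hk HH.
  assert (Hk3 : k ^ 2 * 3 = 4 * x ^ 2).
  { apply Rmult_eq_reg_r with (x ^ 4); [| apply pow_nonzero; lra].
    transitivity (k ^ 2 * heron x x x).
    - unfold heron. ring.
    - rewrite HH. ring. }
  replace (half_perimeter_sine e x x x X X X)
    with (3 * x * X ^ 2 - e * x ^ 3) by (unfold half_perimeter_sine; ring).
  rewrite EX. destruct He; subst e; nra.
Qed.

(** The Gram determinant of three unit vectors with inner products [a], [b], [c]. *)
Definition gram (a b c : R) : R :=
  1 + 2 * a * b * c - a ^ 2 - b ^ 2 - c ^ 2.

(** Here [al], [be], [ga] are the coordinates of the circumcenter in the basis of
    the vertices; the first three equations say that its inner product with each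
    vertex is [kap], the fourth that it is a unit vector.  Multiplying the linear
    system by the adjugate of its matrix gives [gram * (al + be + ga)], and the sum
    of the entries of that adjugate is [4 * heron x y z]. *)
Lemma gram_circumscribed (e kap x y z al be ga : R) :
  e = 1 \/ e = -1 ->
  let a := 1 - 2 * e * x ^ 2 in
  let b := 1 - 2 * e * y ^ 2 in
  let c := 1 - 2 * e * z ^ 2 in
  al + c * be + b * ga = kap -> c * al + be + a * ga = kap ->
  b * al + a * be + ga = kap -> kap * (al + be + ga) = 1 ->
  gram a b c = 4 * kap ^ 2 * heron x y z.
Proof.
  intros He a b c E1 E2 E3 E0.
  assert (F : gram a b c * (al + be + ga)
    = kap * ((1 - a ^ 2) + (1 - b ^ 2) + (1 - c ^ 2)
             - 2 * (a - b * c) - 2 * (b - c * a) - 2 * (c - a * b))).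
  {
    transitivity
      ((al + c * be + b * ga) * ((1 - a ^ 2) + (a * b - c) + (a * c - b))
       + (c * al + be + a * ga) * ((1 - b ^ 2) + (a * b - c) + (b * c - a))
       + (b * al + a * be + ga) * ((1 - c ^ 2) + (a * c - b) + (b * c - a))).
    - unfold gram. ring.
    - rewrite E1, E2, E3. ring. }
  replace (gram a b c) with (kap * (gram a b c * (al + be + ga))).
  - rewrite F. unfold a, b, c, heron. destruct He; subst e; ring.
  - replace (kap * (gram a b c * (al + be + ga)))
      with (gram a b c * (kap * (al + be + ga))) by ring.
    rewrite E0. ring.
Qed.

Lemma gram_heron (e x y z : R) :
  e = 1 \/ e = -1 ->
  gram (1 - 2 * e * x ^ 2) (1 - 2 * e * y ^ 2) (1 - 2 * e * z ^ 2)
  = 4 * heron x y z - 16 * e * (x * y * z) ^ 2.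
Proof. unfold gram, heron. intros [-> | ->]; ring. Qed.

(** * Incircles through inner products *)

(** In terms of [w = sqrt (1 + y)] the left-hand side is [(w - 1) ^ 2 / 2] and the
    right-hand side is [(w - 1) ^ 2 * (w + 1) ^ 2 / 2]. *)
Lemma sqrt_taylor (y : R) :
  0 <= 1 + y -> Rabs (sqrt (1 + y) - 1 - y / 2) <= y ^ 2 / 2.
Proof.
  intros Hy. pose proof (sqrt_pos (1 + y)) as Hw.
  pose proof (pow2_sqrt (1 + y) Hy) as Hw2.
  set (w := sqrt (1 + y)) in *.
  replace y with (w ^ 2 - 1) by lra.
  pose proof (pow2_ge_0 (w - 1)). pose proof (pow2_ge_0 ((w - 1) * w)).
  assert (0 <= (w - 1) ^ 2 * w) by (apply Rmult_le_pos; lra).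
  apply Rabs_le. nra.
Qed.

Lemma edge_quadratic_pos (c s t : R) :
  -1 < c -> 0 <= s -> 0 <= t -> 0 < s + t -> 0 < s ^ 2 + t ^ 2 + 2 * c * s * t.
Proof.
  intros Hc Hs Ht Hst.
  replace (s ^ 2 + t ^ 2 + 2 * c * s * t)
    with ((s - t) ^ 2 + 2 * (1 + c) * (s * t)) by ring.
  pose proof (pow2_ge_0 (s - t)). pose proof (Rmult_le_pos s t Hs Ht).
  destruct (Req_dec (s - t) 0) as [E | E].
  - assert (0 < s * t) by (replace t with s by lra; nra). nra.
  - pose proof (Rsqr_pos_lt _ E). unfold Rsqr in *. nra.
Qed.

(** An edge from [A] to [B], with [c] the (hyperbolic) cosine of its length, consists of
    the points [s * A + t * B] normalized as below, and a point with inner products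
    [p], [q] with [A], [B] has inner product [s * p + t * q] with them.  Both in
    spherical and in hyperbolic geometry, being nearest means having the largest
    inner product [m] (for the Lorentz form in the second case), so that the two
    geometries share this encoding. *)
Definition nearest_on_edge (c p q m : R) : Prop :=
  (exists s t, 0 <= s /\ 0 <= t /\ s ^ 2 + t ^ 2 + 2 * c * s * t = 1 /\
     s * p + t * q = m) /\
  (forall s t, 0 <= s -> 0 <= t -> s ^ 2 + t ^ 2 + 2 * c * s * t = 1 ->
     s * p + t * q <= m).

Lemma nearest_on_edge_sym (c p q m : R) :
  nearest_on_edge c p q m -> nearest_on_edge c q p m.
Proof.
  intros [(s & t & Hs & Ht & HN & Hm) Hmax]. split.
  - exists t, s. repeat split; try assumption; rewrite <- ?HN, <- ?Hm; ring.
  - intros s' t' Hs' Ht' HN'. rewrite Rplus_comm. apply Hmax; try assumption.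
    rewrite <- HN'. ring.
Qed.

(** First-order condition at the nearest point [P]: moving from [P] towards [B], that
    is to [P + h * B] divided by its norm, cannot increase the inner product to first
    order in [h]. *)
Lemma nearest_on_edge_gradient (c p q m s t : R) :
  -1 < c -> nearest_on_edge c p q m ->
  0 <= s -> 0 <= t -> s ^ 2 + t ^ 2 + 2 * c * s * t = 1 -> s * p + t * q = m ->
  q <= m * (t + c * s).
Proof.
  intros Hc [_ Hmax] Hs Ht HN Hm.
  set (tau := t + c * s).
  set (K := Rabs m * (1 + (2 * Rabs tau + 1) ^ 2) / 2).
  assert (HK : 0 <= K).
  { unfold K. pose proof (Rabs_pos m). pose proof (pow2_ge_0 (2 * Rabs tau + 1)).
    nra. }
  (* The norm is [1 + h * tau] up to an error of order [h ^ 2], uniformly in [h]. *)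
  assert (step : forall h, 0 < h -> h <= 1 -> q - m * tau <= h * K).
  { intros h Hh Hh1.
    set (y := 2 * h * tau + h ^ 2).
    assert (EN : s ^ 2 + (t + h) ^ 2 + 2 * c * s * (t + h) = 1 + y)
      by (unfold y, tau; rewrite <- HN; ring).
    assert (HNp : 0 < 1 + y)
      by (rewrite <- EN; apply edge_quadratic_pos; lra).
    pose proof (sqrt_taylor y (Rlt_le _ _ HNp)) as HT.
    pose proof (sqrt_lt_R0 _ HNp) as Hw.
    pose proof (pow2_sqrt (1 + y) (Rlt_le _ _ HNp)) as Hw2.
    set (w := sqrt (1 + y)) in *.
    assert (Hle : s / w * p + (t + h) / w * q <= m).
    { apply Hmax.
      - apply Rmult_le_pos; [lra | left; now apply Rinv_0_lt_compat].
      - apply Rmult_le_pos; [lra | left; now apply Rinv_0_lt_compat].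
      - replace (_ + _ + _) with ((s ^ 2 + (t + h) ^ 2 + 2 * c * s * (t + h)) / w ^ 2)
          by (field; lra).
        rewrite EN, Hw2. field. lra. }
    assert (Hle' : m + h * q <= m * w).
    { apply Rmult_le_compat_r with (r := w) in Hle; [| lra].
      replace ((s / w * p + (t + h) / w * q) * w) with (m + h * q) in Hle
        by (rewrite <- Hm; field; lra).
      exact Hle. }
    assert (Hy : Rabs y <= h * (2 * Rabs tau + 1)).
    { unfold y. replace (2 * h * tau + h ^ 2) with (h * (2 * tau + h)) by ring.
      rewrite Rabs_mult, (Rabs_pos_eq h) by lra.
      apply Rmult_le_compat_l; [lra |].
      eapply Rle_trans; [apply Rabs_triang |].
      rewrite Rabs_mult, (Rabs_pos_eq 2), (Rabs_pos_eq h); lra. }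
    assert (Hy2 : y ^ 2 <= h ^ 2 * (2 * Rabs tau + 1) ^ 2).
    { rewrite <- (pow2_abs y), <- Rpow_mult_distr.
      apply pow_incr. split; [apply Rabs_pos | exact Hy]. }
    assert (Hmw : m * (w - 1 - y / 2) <= Rabs m * (y ^ 2 / 2)).
    { eapply Rle_trans; [apply Rle_abs |]. rewrite Rabs_mult.
      apply Rmult_le_compat_l; [apply Rabs_pos | exact HT]. }
    assert (Hmy : Rabs m * (y ^ 2 / 2)
                  <= Rabs m * (h ^ 2 * (2 * Rabs tau + 1) ^ 2 / 2)).
    { apply Rmult_le_compat_l; [apply Rabs_pos | lra]. }
    assert (Hmh : m * (h ^ 2 / 2) <= Rabs m * (h ^ 2 / 2)).
    { apply Rmult_le_compat_r; [nra | apply Rle_abs]. }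
    apply Rmult_le_reg_l with h; [lra |].
    replace (h * (h * K)) with (Rabs m * (h ^ 2 / 2)
      + Rabs m * (h ^ 2 * (2 * Rabs tau + 1) ^ 2 / 2)) by (unfold K; field).
    replace (m * (w - 1 - y / 2)) with (m * w - m - h * (m * tau) - m * (h ^ 2 / 2))
      in Hmw by (unfold y; field).
    lra. }
  apply Rnot_lt_le. intros Hlt.
  set (d := q - m * tau) in *. assert (Hd : 0 < d) by (unfold d; lra).
  assert (Hh : 0 < d / (d + K + 1)) by (apply Rdiv_lt_0_compat; lra).
  assert (E : d / (d + K + 1) * (d + K + 1) = d) by (field; lra).
  assert (Hh1 : d / (d + K + 1) <= 1) by nra.
  specialize (step _ Hh Hh1). nra.
Qed.

(** The nearest point is an endpoint, or the first-order condition holds with equality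
    in both directions of the edge and the point is the foot of a perpendicular. *)
Lemma nearest_on_edge_cases (c p q m : R) :
  -1 < c -> nearest_on_edge c p q m ->
  (p = m /\ q <= c * m) \/ (q = m /\ p <= c * m) \/
  p ^ 2 + q ^ 2 - 2 * c * p * q = m ^ 2 * (1 - c ^ 2).
Proof.
  intros Hc H. pose proof (nearest_on_edge_sym _ _ _ _ H) as H'.
  pose proof H as [(s & t & Hs & Ht & HN & Hm) _].
  pose proof (nearest_on_edge_gradient c p q m s t Hc H Hs Ht HN Hm) as Hq.
  assert (Hp : p <= m * (s + c * t)).
  { apply nearest_on_edge_gradient with (1 := Hc) (2 := H'); try assumption.
    - rewrite <- HN. ring.
    - rewrite <- Hm. ring. }
  destruct (Req_dec t 0) as [-> | Ht0].
  { left. assert (s = 1) by nra. subst s. split; lra. }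
  destruct (Req_dec s 0) as [-> | Hs0].
  { right; left. assert (t = 1) by nra. subst t. split; lra. }
  right; right.
  (* Complementary slackness: both terms are nonnegative and their sum is zero. *)
  assert (HS : s * (m * (s + c * t) - p) + t * (m * (t + c * s) - q) = 0).
  { transitivity (m * (s ^ 2 + t ^ 2 + 2 * c * s * t) - (s * p + t * q)); [ring |].
    rewrite HN, Hm. ring. }
  assert (Ep : p = m * (s + c * t)) by nra.
  assert (Eq : q = m * (t + c * s)) by nra.
  rewrite Ep, Eq.
  transitivity (m ^ 2 * (1 - c ^ 2) * (s ^ 2 + t ^ 2 + 2 * c * s * t)); [ring |].
  rewrite HN. ring.
Qed.

Lemma nearest_on_edge_at_vertex (c p q m : R) :
  -1 < c -> nearest_on_edge c p q m -> p = m -> q <= c * m.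
Proof.
  intros Hc H Hp. replace (c * m) with (m * (0 + c * 1)) by ring.
  apply nearest_on_edge_gradient with (1 := Hc) (2 := H); lra.
Qed.

(** The point is [I = s * A + t * B + u * C], and [p], [q], [w] are its inner products
    with [A], [B], [C].  If both edges at [A] left [A] at an obtuse or right angle with
    the direction of [I], the component of [I] tangent at [A], which is a positive
    combination of the directions of these edges, would have nonpositive square.
    But the tangent plane is positive definite, and the two directions
    are independent because [gram a b c] is positive. *)
Lemma vertex_not_nearest (e a b c s t u : R) :
  e = 1 \/ e = -1 ->
  0 < s -> 0 < t -> 0 < u ->
  0 < e * (1 - b ^ 2) -> 0 < e * (1 - c ^ 2) -> 0 < gram a b c ->
  let p := e * (s + t * c + u * b) in
  let q := e * (s * c + t + u * a) in
  let w := e * (s * b + t * a + u) in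
  s * p + t * q + u * w = e -> q <= c * p -> w <= b * p -> False.
Proof.
  intros He Hs Ht Hu Hb Hc HG p q w Hn Hq Hw.
  assert (E : e * (1 - p ^ 2)
    = t ^ 2 * (e * (1 - c ^ 2)) + u ^ 2 * (e * (1 - b ^ 2))
      + 2 * t * u * (e * (a - c * b))).
  { transitivity (s * p + t * q + u * w - e * p ^ 2); [rewrite Hn; ring |].
    unfold p, q, w. destruct He; subst e; ring. }
  assert (Hle : e * (1 - p ^ 2) <= 0).
  { replace (e * (1 - p ^ 2)) with (s * p + t * q + u * w - e * p ^ 2)
      by (rewrite Hn; ring).
    replace (e * p ^ 2) with (s * p + t * (c * p) + u * (b * p))
      by (unfold p; destruct He; subst e; ring).
    nra. }
  set (S := e * (1 - c ^ 2)) in *. set (T := e * (1 - b ^ 2)) in *.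
  set (g := e * (a - c * b)) in *.
  assert (HST : S * T - g ^ 2 = gram a b c)
    by (unfold S, T, g, gram; destruct He; subst e; ring).
  assert (0 < S * (t ^ 2 * S + u ^ 2 * T + 2 * t * u * g)).
  { replace (S * (t ^ 2 * S + u ^ 2 * T + 2 * t * u * g))
      with ((t * S + u * g) ^ 2 + u ^ 2 * (S * T - g ^ 2)) by ring.
    rewrite HST. pose proof (pow2_ge_0 (t * S + u * g)).
    assert (0 < u ^ 2 * gram a b c) by (apply Rmult_lt_0_compat; nra). lra. }
  nra.
Qed.

(** Both sides are, up to a common sign, the squared volume spanned by [I], [A], [B]:
    computed from the coordinate [u] of [I] along [C], and as the squared area spanned
    by [A], [B] times the squared distance of [I] to their plane. *)
Lemma foot_equation (e a b c s t u m : R) :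
  e = 1 \/ e = -1 ->
  let p := e * (s + t * c + u * b) in
  let q := e * (s * c + t + u * a) in
  let w := e * (s * b + t * a + u) in
  s * p + t * q + u * w = e ->
  p ^ 2 + q ^ 2 - 2 * c * p * q = m ^ 2 * (1 - c ^ 2) ->
  u ^ 2 * gram a b c = (1 - c ^ 2) * (1 - m ^ 2).
Proof.
  intros He p q w Hn Hf.
  assert (Hn' : e * (s * p + t * q + u * w) = 1)
    by (rewrite Hn; destruct He; subst e; ring).
  transitivity ((1 - c ^ 2) * (e * (s * p + t * q + u * w))
                - (p ^ 2 + q ^ 2 - 2 * c * p * q)).
  - unfold p, q, w, gram. destruct He; subst e; ring.
  - rewrite Hn', Hf. ring.
Qed.

(** The incenter is at the same distance from all three edges, so an endpoint of one edge
    that is nearest on it is nearest on the other edge at that vertex as well, which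
    [vertex_not_nearest] excludes.  So the circle touches each edge at the foot of a
    perpendicular. *)
Lemma inscribed_weights (e a b c s t u m : R) :
  e = 1 \/ e = -1 ->
  0 < s -> 0 < t -> 0 < u -> -1 < a -> -1 < b -> -1 < c ->
  0 < e * (1 - a ^ 2) -> 0 < e * (1 - b ^ 2) -> 0 < e * (1 - c ^ 2) ->
  0 < gram a b c ->
  let p := e * (s + t * c + u * b) in
  let q := e * (s * c + t + u * a) in
  let w := e * (s * b + t * a + u) in
  s * p + t * q + u * w = e ->
  nearest_on_edge c p q m -> nearest_on_edge a q w m ->
  nearest_on_edge b w p m ->
  s ^ 2 * gram a b c = (1 - a ^ 2) * (1 - m ^ 2) /\
  t ^ 2 * gram a b c = (1 - b ^ 2) * (1 - m ^ 2) /\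
  u ^ 2 * gram a b c = (1 - c ^ 2) * (1 - m ^ 2).
Proof.
  intros He Hs Ht Hu Ha1 Hb1 Hc1 Ha Hb Hc HG p q w Hn NAB NBC NCA.
  pose proof (nearest_on_edge_sym _ _ _ _ NAB) as NBA.
  pose proof (nearest_on_edge_sym _ _ _ _ NBC) as NCB.
  pose proof (nearest_on_edge_sym _ _ _ _ NCA) as NAC.
  assert (Gcyc : gram b c a = gram a b c) by (unfold gram; ring).
  assert (Gcyc' : gram c a b = gram a b c) by (unfold gram; ring).
  assert (FA : p <> m).
  { intros E. apply (vertex_not_nearest e a b c s t u He); auto; fold p q w.
    - rewrite E. now apply nearest_on_edge_at_vertex with p.
    - rewrite E. now apply nearest_on_edge_at_vertex with p. }
  assert (FB : q <> m).
  { intros E. apply (vertex_not_nearest e b c a t u s He); auto;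
      rewrite ?Gcyc; auto;
      replace (e * (t + u * a + s * c)) with q by (unfold q; ring);
      replace (e * (t * a + u + s * b)) with w by (unfold w; ring);
      replace (e * (t * c + u * b + s)) with p by (unfold p; ring).
    - rewrite <- Hn. ring.
    - rewrite E. now apply nearest_on_edge_at_vertex with q.
    - rewrite E. now apply nearest_on_edge_at_vertex with q. }
  assert (FC : w <> m).
  { intros E. apply (vertex_not_nearest e c a b u s t He); auto;
      rewrite ?Gcyc'; auto;
      replace (e * (u + s * b + t * a)) with w by (unfold w; ring);
      replace (e * (u * b + s + t * c)) with p by (unfold p; ring);
      replace (e * (u * a + s * c + t)) with q by (unfold q; ring).
    - rewrite <- Hn. ring.
    - rewrite E. now apply nearest_on_edge_at_vertex with w.
    - rewrite E. now apply nearest_on_edge_at_vertex with w. }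
  assert (foot : forall c p q, -1 < c -> p <> m -> q <> m ->
    nearest_on_edge c p q m ->
    p ^ 2 + q ^ 2 - 2 * c * p * q = m ^ 2 * (1 - c ^ 2)).
  { intros c' p' q' H1 H2 H3 H4.
    destruct (nearest_on_edge_cases c' p' q' m H1 H4) as [[]|[[]|]]; tauto. }
  repeat split.
  - rewrite <- Gcyc. apply (foot_equation e b c a t u s m He).
    + transitivity (s * p + t * q + u * w); [unfold p, q, w; ring | exact Hn].
    + rewrite <- (foot a q w) by assumption. unfold q, w. ring.
  - rewrite <- Gcyc'. apply (foot_equation e c a b u s t m He).
    + transitivity (s * p + t * q + u * w); [unfold p, q, w; ring | exact Hn].
    + rewrite <- (foot b w p) by assumption. unfold p, w. ring.
  - apply (foot_equation e a b c s t u m He); [exact Hn |].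
    now apply foot.
Qed.

(** By [inscribed_weights] the coordinates of the incenter are proportional to the sines
    of the opposite sides; that it is a unit vector fixes the factor. *)
Lemma inradius_scalar (e a b c s t u m delta sa sb sc : R) :
  e = 1 \/ e = -1 -> 0 < s -> 0 < t -> 0 < u ->
  0 < sa -> 0 < sb -> 0 < sc -> 0 <= delta ->
  sa ^ 2 = e * (1 - a ^ 2) -> sb ^ 2 = e * (1 - b ^ 2) ->
  sc ^ 2 = e * (1 - c ^ 2) -> delta ^ 2 = e * (1 - m ^ 2) ->
  0 < gram a b c ->
  s ^ 2 + t ^ 2 + u ^ 2 + 2 * (c * s * t + a * t * u + b * s * u) = 1 ->
  s ^ 2 * gram a b c = (1 - a ^ 2) * (1 - m ^ 2) ->
  t ^ 2 * gram a b c = (1 - b ^ 2) * (1 - m ^ 2) ->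
  u ^ 2 * gram a b c = (1 - c ^ 2) * (1 - m ^ 2) ->
  delta ^ 2 * (sa ^ 2 + sb ^ 2 + sc ^ 2
    + 2 * (c * sa * sb + a * sb * sc + b * sa * sc)) = gram a b c.
Proof.
  intros He Hs Ht Hu Hsa Hsb Hsc Hd Ea Eb Ec Ed HG Hn E1 E2 E3.
  set (D := sqrt (gram a b c)).
  assert (HD : 0 < D) by now apply sqrt_lt_R0.
  assert (HD2 : D ^ 2 = gram a b c) by (apply pow2_sqrt; lra).
  assert (W : forall v sv w, 0 < v -> 0 < sv -> sv ^ 2 = e * (1 - w ^ 2) ->
    v ^ 2 * gram a b c = (1 - w ^ 2) * (1 - m ^ 2) -> v = sv * delta / D).
  { intros v sv w Hv Hsv Esv Ev.
    assert (v * D = sv * delta).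
    { apply Rsqr_inj; [nra | nra |]. unfold Rsqr.
      transitivity (v ^ 2 * D ^ 2); [ring |]. rewrite HD2, Ev.
      transitivity (sv ^ 2 * delta ^ 2); [| ring]. rewrite Esv, Ed.
      destruct He; subst e; ring. }
    apply Rmult_eq_reg_r with D; [| lra]. rewrite H. field. lra. }
  rewrite (W s sa a), (W t sb b), (W u sc c) in Hn by assumption.
  rewrite <- HD2. rewrite <- (Rmult_1_r (D ^ 2)), <- Hn. field. lra.
Qed.

(** [sa * A + sb * B + sc * C] is a multiple of the incenter.  On the sphere its square minus
    [gram a b c] collapses to [2 - 2 * cos p], where [p] is the perimeter, and this is
    four times the squared sine of the half perimeter; the hyperbolic case is the
    same up to signs. *)
Lemma inradius_half_perimeter (e x y z X Y Z delta m : R) :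
  e = 1 \/ e = -1 ->
  X ^ 2 = 1 - e * x ^ 2 -> Y ^ 2 = 1 - e * y ^ 2 -> Z ^ 2 = 1 - e * z ^ 2 ->
  delta ^ 2 = e * (1 - m ^ 2) ->
  let a := 1 - 2 * e * x ^ 2 in
  let b := 1 - 2 * e * y ^ 2 in
  let c := 1 - 2 * e * z ^ 2 in
  let sa := 2 * x * X in let sb := 2 * y * Y in let sc := 2 * z * Z in
  delta ^ 2 * (sa ^ 2 + sb ^ 2 + sc ^ 2
    + 2 * (c * sa * sb + a * sb * sc + b * sa * sc)) = gram a b c ->
  4 * half_perimeter_sine e x y z X Y Z ^ 2 * delta ^ 2 = m ^ 2 * gram a b c.
Proof.
  intros He EX EY EZ Ed a b c sa sb sc HQ.
  assert (Em : m ^ 2 = 1 - e * delta ^ 2)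
    by (rewrite Ed; destruct He; subst e; ring).
  rewrite Em.
  assert (E : 4 * half_perimeter_sine e x y z X Y Z ^ 2
    = sa ^ 2 + sb ^ 2 + sc ^ 2
      + 2 * (c * sa * sb + a * sb * sc + b * sa * sc) - e * gram a b c).
  { unfold half_perimeter_sine, sa, sb, sc.
    transitivity (4 * (x ^ 2 * Y ^ 2 * Z ^ 2 + X ^ 2 * y ^ 2 * Z ^ 2
        + X ^ 2 * Y ^ 2 * z ^ 2 + e * e * (x * y * z) ^ 2
      + 2 * x * y * X * Y * Z ^ 2 + 2 * x * z * X * Z * Y ^ 2
      + 2 * y * z * Y * Z * X ^ 2
      - 2 * e * x * y * z * (x * Y * Z + X * y * Z + X * Y * z))); [ring |].
    transitivity (4 * x ^ 2 * X ^ 2 + 4 * y ^ 2 * Y ^ 2 + 4 * z ^ 2 * Z ^ 2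
      + 8 * (c * x * y * X * Y + a * y * z * Y * Z + b * x * z * X * Z)
      - e * gram a b c); [| ring].
    rewrite EX, EY, EZ. unfold a, b, c, gram. destruct He; subst e; ring. }
  rewrite E. rewrite <- HQ at 2.
  set (Q := sa ^ 2 + _ + _ + _) in *.
  transitivity (delta ^ 2 * Q - e * delta ^ 2 * gram a b c); [ring |].
  rewrite HQ. ring.
Qed.

(** * Triangles on the quadrics *)

(** With [e = 1] this is [dot], with [e = -1] it is [lorentz]; points of either
    geometry have square [e], and [e] times the form is the (hyperbolic) cosine of
    the distance. *)
Definition form (e : R) (u v : vec3) : R :=
  let '(u1, u2, u3) := u in
  let '(v1, v2, v3) := v in u1 * v1 + u2 * v2 + e * (u3 * v3).

Lemma dot_form (u v : vec3) : dot u v = form 1 u v.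
Proof. destruct u as [[]], v as [[]]. simpl. ring. Qed.

Lemma lorentz_form (u v : vec3) : lorentz u v = form (-1) u v.
Proof. destruct u as [[]], v as [[]]. simpl. ring. Qed.

Lemma form_sym (e : R) (u v : vec3) : form e u v = form e v u.
Proof. destruct u as [[]], v as [[]]. simpl. ring. Qed.

Lemma form_add_l (e : R) (u v w : vec3) :
  form e (add3 u v) w = form e u w + form e v w.
Proof. destruct u as [[]], v as [[]], w as [[]]. simpl. ring. Qed.

Lemma form_scale_l (e t : R) (u v : vec3) :
  form e (scale3 t u) v = t * form e u v.
Proof. destruct u as [[]], v as [[]]. simpl. ring. Qed.

Lemma form_combination2 (e s t : R) (A B P : vec3) :
  form e P (add3 (scale3 s A) (scale3 t B)) = s * form e P A + t * form e P B.
Proof.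
  rewrite form_sym, form_add_l, !form_scale_l, (form_sym e A), (form_sym e B).
  reflexivity.
Qed.

Lemma form_combination3 (e s t u : R) (A B C P : vec3) :
  form e (add3 (add3 (scale3 s A) (scale3 t B)) (scale3 u C)) P
  = s * form e A P + t * form e B P + u * form e C P.
Proof. now rewrite !form_add_l, !form_scale_l. Qed.

Lemma form_segment (e c s t : R) (A B : vec3) :
  form e A A = e -> form e B B = e -> form e A B = e * c ->
  form e (add3 (scale3 s A) (scale3 t B)) (add3 (scale3 s A) (scale3 t B))
  = e * (s ^ 2 + t ^ 2 + 2 * c * s * t).
Proof.
  intros HA HB HAB.
  rewrite form_combination2, !form_add_l, !form_scale_l, (form_sym e B A).
  rewrite HA, HB, HAB. ring.
Qed.

Definition det3 (u v w : vec3) : R :=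
  let '(u1, u2, u3) := u in
  let '(v1, v2, v3) := v in
  let '(w1, w2, w3) := w in
  u1 * (v2 * w3 - v3 * w2) - u2 * (v1 * w3 - v3 * w1) + u3 * (v1 * w2 - v2 * w1).

Definition cross (u v : vec3) : vec3 :=
  let '(u1, u2, u3) := u in
  let '(v1, v2, v3) := v in
  (u2 * v3 - u3 * v2, u3 * v1 - u1 * v3, u1 * v2 - u2 * v1).

(** A vanishing determinant yields a common normal vector: a cross product of two
    of the vectors, or, if both [B] and [C] are multiples of [A], any vector orthogonal
    to [A]. *)
Lemma det3_neq_0 (A B C : vec3) :
  A <> zero3 -> no_common_geodesic A B C -> det3 A B C <> 0.
Proof.
  intros HA Hn Hdet. apply Hn. clear Hn.
  assert (cross_case : cross A B <> zero3 \/ cross A C <> zero3 \/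
                       (cross A B = zero3 /\ cross A C = zero3)).
  { assert (D : forall u : vec3, u = zero3 \/ u <> zero3).
    { intros [[u1 u2] u3]. unfold zero3.
      destruct (Req_dec u1 0); [| right; congruence].
      destruct (Req_dec u2 0); [| right; congruence].
      destruct (Req_dec u3 0); [left | right]; congruence. }
    destruct (D (cross A B)), (D (cross A C)); tauto. }
  destruct cross_case as [H | [H | [HB HC]]].
  - exists (cross A B). split; [exact H |].
    destruct A as [[a1 a2] a3], B as [[b1 b2] b3], C as [[c1 c2] c3].
    simpl in *. repeat split; try ring. rewrite <- Hdet. ring.
  - exists (cross A C). split; [exact H |].
    destruct A as [[a1 a2] a3], B as [[b1 b2] b3], C as [[c1 c2] c3].
    simpl in *. repeat split; try ring.
    rewrite <- (Rmult_0_r (-1)), <- Hdet. ring.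
  - destruct A as [[a1 a2] a3], B as [[b1 b2] b3], C as [[c1 c2] c3].
    unfold cross, zero3 in HB, HC. injection HB as B1 B2 B3.
    injection HC as C1 C2 C3.
    destruct (Req_dec a1 0) as [E1 | E1].
    + exists (1, 0, 0). split; [unfold zero3; intros E; injection E; lra |].
      assert (H : forall b1 b2 b3, a3 * b1 - a1 * b3 = 0 ->
                    a1 * b2 - a2 * b1 = 0 -> b1 = 0).
      { intros x1 x2 x3 F1 F2. rewrite E1 in F1, F2.
        destruct (Req_dec x1 0) as [| Hx]; [assumption | exfalso].
        apply HA. unfold zero3. rewrite E1.
        assert (a3 = 0) by (apply Rmult_eq_reg_r with x1; lra).
        assert (a2 = 0) by (apply Rmult_eq_reg_r with x1; lra). congruence. }
      simpl. rewrite (H b1 b2 b3), (H c1 c2 c3), E1 by assumption.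
      repeat split; ring.
    + exists (- a2, a1, 0).
      split; [unfold zero3; intros E; injection E; lra |].
      simpl. repeat split; lra.
Qed.

Lemma cramer (A B C P : vec3) :
  det3 A B C <> 0 ->
  exists al be ga, P = add3 (add3 (scale3 al A) (scale3 be B)) (scale3 ga C).
Proof.
  intros HD.
  exists (det3 P B C / det3 A B C), (det3 A P C / det3 A B C),
    (det3 A B P / det3 A B C).
  destruct A as [[a1 a2] a3], B as [[b1 b2] b3], C as [[c1 c2] c3],
    P as [[p1 p2] p3]. simpl in *.
  f_equal; [f_equal |]; field; exact HD.
Qed.

Lemma gram_det3 (e a b c : R) (A B C : vec3) :
  e = 1 \/ e = -1 ->
  form e A A = e -> form e B B = e -> form e C C = e ->
  form e B C = e * a -> form e C A = e * b -> form e A B = e * c ->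
  gram a b c = det3 A B C ^ 2.
Proof.
  intros He HA HB HC Ha Hb Hc.
  assert (E : form e A A * form e B B * form e C C
    + 2 * form e B C * form e C A * form e A B
    - form e A A * form e B C ^ 2 - form e B B * form e C A ^ 2
    - form e C C * form e A B ^ 2 = e * det3 A B C ^ 2).
  { clear. destruct A as [[a1 a2] a3], B as [[b1 b2] b3], C as [[c1 c2] c3].
    simpl. ring. }
  rewrite HA, HB, HC, Ha, Hb, Hc in E. unfold gram.
  destruct He; subst e; lra.
Qed.

(** With [gram_heron] this yields [k ^ 2 * heron x y z = 4 * (x * y * z) ^ 2].  On
    the sphere it says that the circle through the vertices, which lies in the plane at
    distance [kap] from the origin, has Euclidean radius [k]. *)
Lemma gram_circumcenter (e kap x y z : R) (A B C O : vec3) :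
  e = 1 \/ e = -1 ->
  form e A A = e -> form e B B = e -> form e C C = e -> form e O O = e ->
  form e B C = e * (1 - 2 * e * x ^ 2) ->
  form e C A = e * (1 - 2 * e * y ^ 2) ->
  form e A B = e * (1 - 2 * e * z ^ 2) ->
  form e O A = e * kap -> form e O B = e * kap -> form e O C = e * kap ->
  det3 A B C <> 0 ->
  gram (1 - 2 * e * x ^ 2) (1 - 2 * e * y ^ 2) (1 - 2 * e * z ^ 2)
  = 4 * kap ^ 2 * heron x y z.
Proof.
  intros He HA HB HC HO Ha Hb Hc OA OB OC HD.
  destruct (cramer A B C O HD) as (al & be & ga & EO).
  assert (Hreg : forall p q, e * p = e * q -> p = q).
  { intros p q H. destruct He; subst e; lra. }
  assert (FA := OA). rewrite EO, form_combination3 in FA.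
  rewrite (form_sym e B A), HA, Hb, Hc in FA.
  assert (FB := OB). rewrite EO, form_combination3 in FB.
  rewrite (form_sym e C B), HB, Ha, Hc in FB.
  assert (FC := OC). rewrite EO, form_combination3 in FC.
  rewrite (form_sym e A C), HC, Ha, Hb in FC.
  assert (FO := HO). rewrite EO in FO at 1. rewrite form_combination3 in FO.
  rewrite (form_sym e A O), (form_sym e B O), (form_sym e C O), OA, OB, OC in FO.
  apply gram_circumscribed with al be ga; [exact He | ..]; apply Hreg.
  - rewrite <- FA. ring.
  - rewrite <- FB. ring.
  - rewrite <- FC. ring.
  - rewrite <- FO at 2. ring.
Qed.

(** The metric data of a triangle that the comparison with Euclidean triangles
    uses: [x], [y], [z] and [X], [Y], [Z] are sines and cosines of the half sides,
    [kap] and [k] cosine and sine of the circumradius, [TR] and [Tr] the tangents of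
    the circumradius and the inradius, all hyperbolic if [e = -1]. *)
Record curved_triangle (e kap k x y z X Y Z TR Tr : R) : Prop := {
  ct_sines : 0 < x /\ 0 < y /\ 0 < z;
  ct_cosines : 0 < X /\ 0 < Y /\ 0 < Z;
  ct_squares : X ^ 2 = 1 - e * x ^ 2 /\ Y ^ 2 = 1 - e * y ^ 2 /\
               Z ^ 2 = 1 - e * z ^ 2;
  ct_kap : 0 < kap;
  ct_k : k ^ 2 = e * (1 - kap ^ 2);
  ct_heron : 0 < heron x y z;
  ct_chord_circumradius : k ^ 2 * heron x y z = 4 * (x * y * z) ^ 2;
  ct_half_perimeter : 0 < half_perimeter_sine e x y z X Y Z;
  ct_circumradius : TR = 2 * (x * y * z) / (kap * sqrt (heron x y z));
  ct_inradius :
    Tr = kap * sqrt (heron x y z) / half_perimeter_sine e x y z X Y Z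
}.

(** Here [delta / mu] is the tangent of the inradius.  The sign of [m], the inner product
    of the incenter with the points of contact, is that of [e], which is why its
    absolute value [mu] appears separately. *)
Lemma curved_radii (e kap k m mu delta x y z X Y Z s t u : R)
    (A B C O I : vec3) :
  e = 1 \/ e = -1 ->
  form e A A = e -> form e B B = e -> form e C C = e ->
  form e O O = e -> form e I I = e -> det3 A B C <> 0 ->
  form e B C = e * (1 - 2 * e * x ^ 2) ->
  form e C A = e * (1 - 2 * e * y ^ 2) ->
  form e A B = e * (1 - 2 * e * z ^ 2) ->
  0 < x -> 0 < y -> 0 < z -> 0 < X -> 0 < Y -> 0 < Z ->
  X ^ 2 = 1 - e * x ^ 2 -> Y ^ 2 = 1 - e * y ^ 2 -> Z ^ 2 = 1 - e * z ^ 2 ->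
  form e O A = e * kap -> form e O B = e * kap -> form e O C = e * kap ->
  0 < kap -> 0 <= k -> k ^ 2 = e * (1 - kap ^ 2) ->
  0 < s -> 0 < t -> 0 < u ->
  I = add3 (add3 (scale3 s A) (scale3 t B)) (scale3 u C) ->
  nearest_on_edge (1 - 2 * e * z ^ 2) (form e I A) (form e I B) m ->
  nearest_on_edge (1 - 2 * e * x ^ 2) (form e I B) (form e I C) m ->
  nearest_on_edge (1 - 2 * e * y ^ 2) (form e I C) (form e I A) m ->
  0 < mu -> mu ^ 2 = m ^ 2 -> 0 <= delta -> delta ^ 2 = e * (1 - m ^ 2) ->
  curved_triangle e kap k x y z X Y Z (k / kap) (delta / mu).
Proof.
  intros He HA HB HC HO HI HD Ha Hb Hc Hx Hy Hz HX HY HZ EX EY EZ OA OB OC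
    Hkap Hk Ek Hs Ht Hu EI NAB NBC NCA Hmu Emu Hdel Edel.
  set (sn := half_perimeter_sine e x y z X Y Z).
  set (h := sqrt (heron x y z)).
  pose proof (gram_det3 e _ _ _ A B C He HA HB HC Ha Hb Hc) as G1.
  pose proof (gram_circumcenter e kap x y z A B C O He HA HB HC HO Ha Hb Hc
                OA OB OC HD) as G2.
  pose proof (gram_heron e x y z He) as G3.
  set (a := 1 - 2 * e * x ^ 2) in *. set (b := 1 - 2 * e * y ^ 2) in *.
  set (c := 1 - 2 * e * z ^ 2) in *.
  assert (HG : 0 < gram a b c).
  { rewrite G1. pose proof (Rsqr_pos_lt _ HD). unfold Rsqr in *. simpl. lra. }
  assert (HH : 0 < heron x y z).
  { assert (0 < kap ^ 2) by (now apply pow_lt). nra. }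
  assert (Hxyz : 0 < x * y * z) by (repeat apply Rmult_lt_0_compat; assumption).
  assert (EkH : k ^ 2 * heron x y z = 4 * (x * y * z) ^ 2).
  { rewrite Ek. destruct He; subst e; lra. }
  assert (Hsn : 0 < sn).
  { pose proof (half_perimeter_sine_comparison e kap k x y z X Y Z He Hx Hy Hz
                  HX HY HZ EX EY EZ Ek EkH) as Hcmp. fold sn in Hcmp.
    destruct He as [E | E]; rewrite E in Hcmp.
    - assert (0 < kap ^ 2) by (now apply pow_lt). nra.
    - unfold sn, half_perimeter_sine. rewrite E.
      assert (0 < x * Y * Z) by (repeat apply Rmult_lt_0_compat; assumption).
      assert (0 < X * y * Z) by (repeat apply Rmult_lt_0_compat; assumption).
      assert (0 < X * Y * z) by (repeat apply Rmult_lt_0_compat; assumption).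
      lra. }
  assert (Hh : 0 < h) by now apply sqrt_lt_R0.
  assert (Hh2 : h ^ 2 = heron x y z) by (apply pow2_sqrt; lra).
  split; fold h sn; auto.
  - assert (E : k * h = 2 * (x * y * z)).
    { apply Rsqr_inj; [nra | lra |]. unfold Rsqr.
      transitivity (k ^ 2 * h ^ 2); [ring |]. rewrite Hh2, EkH. ring. }
    rewrite <- E. field. lra.
  - assert (Hcos : forall w W, 0 < W -> W ^ 2 = 1 - e * w ^ 2 ->
              -1 < 1 - 2 * e * w ^ 2).
    { intros w W HW EW. assert (0 < W ^ 2) by (now apply pow_lt). nra. }
    assert (Hsin : forall w W, W ^ 2 = 1 - e * w ^ 2 ->
              (2 * w * W) ^ 2 = e * (1 - (1 - 2 * e * w ^ 2) ^ 2)).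
    { intros w W EW. transitivity (4 * w ^ 2 * W ^ 2); [ring |].
      rewrite EW. destruct He; subst e; ring. }
    assert (Hsinpos : forall w W, 0 < w -> 0 < W -> W ^ 2 = 1 - e * w ^ 2 ->
              0 < e * (1 - (1 - 2 * e * w ^ 2) ^ 2)).
    { intros w W Hw HW EW. rewrite <- (Hsin w W EW). apply pow_lt.
      apply Rmult_lt_0_compat; lra. }
    assert (Ep : form e I A = e * (s + t * c + u * b)).
    { rewrite EI, form_combination3, (form_sym e B A), HA, Hb, Hc. ring. }
    assert (Eq : form e I B = e * (s * c + t + u * a)).
    { rewrite EI, form_combination3, (form_sym e C B), HB, Ha, Hc. ring. }
    assert (Ew : form e I C = e * (s * b + t * a + u)).
    { rewrite EI, form_combination3, (form_sym e A C), HC, Ha, Hb. ring. }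
    assert (Hn : s * form e I A + t * form e I B + u * form e I C = e).
    { rewrite <- HI at 4. rewrite EI at 4.
      rewrite form_combination3, (form_sym e A I), (form_sym e B I),
        (form_sym e C I). reflexivity. }
    rewrite Ep, Eq in NAB. rewrite Eq, Ew in NBC. rewrite Ew, Ep in NCA.
    rewrite Ep, Eq, Ew in Hn.
    destruct (inscribed_weights e a b c s t u m He Hs Ht Hu
      (Hcos x X HX EX) (Hcos y Y HY EY) (Hcos z Z HZ EZ)
      (Hsinpos x X Hx HX EX) (Hsinpos y Y Hy HY EY) (Hsinpos z Z Hz HZ EZ)
      HG Hn NAB NBC NCA) as (W1 & W2 & W3).
    assert (Hn1 : s ^ 2 + t ^ 2 + u ^ 2 + 2 * (c * s * t + a * t * u + b * s * u) = 1).
    { apply Rmult_eq_reg_l with e; [| destruct He; lra].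
      rewrite <- Hn at 2. ring. }
    assert (HQ : delta ^ 2 * ((2 * x * X) ^ 2 + (2 * y * Y) ^ 2 + (2 * z * Z) ^ 2
      + 2 * (c * (2 * x * X) * (2 * y * Y) + a * (2 * y * Y) * (2 * z * Z)
             + b * (2 * x * X) * (2 * z * Z))) = gram a b c).
    { apply (inradius_scalar e a b c s t u m delta); try assumption;
        try (now apply Hsin); apply Rmult_lt_0_compat; lra. }
    apply (inradius_half_perimeter e x y z X Y Z delta m He EX EY EZ Edel) in HQ.
    fold a b c sn in HQ. rewrite G2, <- Emu in HQ.
    assert (E : sn * delta = mu * (kap * h)).
    { apply Rsqr_inj.
      - apply Rmult_le_pos; lra.
      - left; repeat apply Rmult_lt_0_compat; assumption.
      - unfold Rsqr. transitivity (sn ^ 2 * delta ^ 2); [ring |].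
        transitivity (mu ^ 2 * (kap ^ 2 * h ^ 2)); [| ring].
        rewrite Hh2. lra. }
    apply Rmult_eq_reg_r with (sn * mu); [| nra].
    transitivity (sn * delta); [field; lra |]. rewrite E. field. lra.
Qed.

(** * Comparison with a Euclidean triangle *)

(** Euler's inequality between the Euclidean circumradius and inradius; in terms of
    [p], [q], [r] it is [8 * p * q * r <= (p + q) * (q + r) * (r + p)]. *)
Lemma heron_le (x y z : R) :
  0 < x -> 0 < y -> 0 < z -> 0 < heron x y z ->
  heron x y z <= x * y * z * (x + y + z).
Proof.
  intros Hx Hy Hz HH.
  destruct (heron_pos_triangle_ineq x y z Hx Hy Hz HH) as (H1 & H2 & H3).
  unfold heron.
  set (p := - x + y + z) in *. set (q := x - y + z) in *. set (r := x + y - z) in *.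
  assert (S : p * q * r <= x * y * z).
  { replace x with ((q + r) / 2) by (unfold q, r; field).
    replace y with ((p + r) / 2) by (unfold p, r; field).
    replace z with ((p + q) / 2) by (unfold p, q; field).
    pose proof (pow2_ge_0 (p - q)). pose proof (pow2_ge_0 (q - r)).
    pose proof (pow2_ge_0 (r - p)). nra. }
  replace ((x + y + z) * p * q * r) with (p * q * r * (x + y + z)) by ring.
  apply Rmult_le_compat_r; lra.
Qed.

Lemma le_of_sqr (p q : R) : 0 <= p -> 0 <= q -> p ^ 2 <= q ^ 2 -> p <= q.
Proof. intros. apply Rsqr_incr_0; unfold Rsqr; nra. Qed.

Section Comparison.

Variables (n : R) (f : R -> R -> R) (g : R -> R -> R -> R).
Hypothesis g_homogeneous : homogeneous3 n g.
Hypothesis euclidean_inequality : forall a b c Rad r : R,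
  euclidean_triangle a b c Rad r ->
  f Rad r >= g a b c /\ (f Rad r = g a b c <-> a = b /\ b = c).

Variables (x y z kap sn : R).
Hypotheses (Hx : 0 < x) (Hy : 0 < y) (Hz : 0 < z) (HH : 0 < heron x y z)
  (Hkap : 0 < kap) (Hsn : 0 < sn).

(** [Rad'] and [r'] are the radii of the Euclidean triangle with sides [lam * x],
    [lam * y], [lam * z]; [TR] and [Tr] are the tangents of the radii of the curved
    triangle.  The factor [lam] makes the products of the radii agree. *)
Let lam := 2 * sqrt ((x + y + z) / sn).
Let h := sqrt (heron x y z).
Let Rad' := lam * (x * y * z) / h.
Let r' := lam * h / (2 * (x + y + z)).
Let TR := 2 * (x * y * z) / (kap * h).
Let Tr := kap * h / sn.
Let M := sqrt (x * y * z / sn).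

Lemma scale_factor_spec : 0 < lam /\ lam ^ 2 = 4 * (x + y + z) / sn.
Proof.
  assert (H : 0 < (x + y + z) / sn) by (apply Rdiv_lt_0_compat; lra).
  split; unfold lam.
  - apply Rmult_lt_0_compat; [lra | now apply sqrt_lt_R0].
  - rewrite Rpow_mult_distr, pow2_sqrt by lra. field. lra.
Qed.

Lemma root_heron_spec : 0 < h /\ h ^ 2 = heron x y z.
Proof.
  split; unfold h; [now apply sqrt_lt_R0 | apply pow2_sqrt; lra].
Qed.

Lemma product_pos : 0 < x * y * z.
Proof. repeat apply Rmult_lt_0_compat; assumption. Qed.

Lemma product_root_spec : 0 < M /\ M ^ 2 = x * y * z / sn.
Proof.
  assert (H : 0 < x * y * z / sn)
    by (apply Rdiv_lt_0_compat; [apply product_pos | assumption]).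
  split; unfold M; [now apply sqrt_lt_R0 | apply pow2_sqrt; lra].
Qed.

Lemma scaled_euclidean_triangle :
  euclidean_triangle (lam * x) (lam * y) (lam * z) Rad' r'.
Proof.
  destruct scale_factor_spec as [Hl _]. destruct root_heron_spec as [Hh Hh2].
  assert (EH : heron (lam * x) (lam * y) (lam * z) = (lam ^ 2 * h) ^ 2).
  { rewrite Rpow_mult_distr, Hh2. unfold heron. ring. }
  assert (Hl2 : 0 < lam ^ 2 * h) by (apply Rmult_lt_0_compat; [now apply pow_lt | lra]).
  assert (Es : sqrt (heron (lam * x) (lam * y) (lam * z)) = lam ^ 2 * h)
    by (rewrite EH; apply sqrt_pow2; lra).
  replace Rad' with (lam * x * (lam * y) * (lam * z) / (lam ^ 2 * h))
    by (unfold Rad'; field; lra).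
  replace r' with (lam ^ 2 * h / (2 * (lam * x + lam * y + lam * z))).
  2:{ unfold r'. field. split; [nra |].
      replace (lam * x + lam * y + lam * z) with (lam * (x + y + z)) by ring. nra. }
  rewrite <- Es. apply euclidean_triangle_of_sides;
    try (apply Rmult_lt_0_compat; lra).
  rewrite EH. now apply pow_lt.
Qed.

Lemma g_scaled :
  Rpower 2 n * g x y z * Rpower ((x + y + z) / sn) (n / 2)
  = g (lam * x) (lam * y) (lam * z).
Proof.
  destruct scale_factor_spec as [Hl _].
  assert (H : 0 < (x + y + z) / sn) by (apply Rdiv_lt_0_compat; lra).
  rewrite g_homogeneous by assumption. unfold lam.
  rewrite <- Rpower_mult_distr by (try lra; now apply sqrt_lt_R0).
  rewrite <- Rpower_sqrt by assumption. rewrite Rpower_mult.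
  replace (/ 2 * n) with (n / 2) by field. ring.
Qed.

(** In the equilateral case [lam = 2 / kap], and then the Euclidean radii are [TR] and
    [Tr]. *)
Lemma curved_from_euclidean :
  f Rad' r' <= f TR Tr ->
  (x = y -> y = z -> sn = kap ^ 2 * (x + y + z)) ->
  f TR Tr >= Rpower 2 n * g x y z * Rpower ((x + y + z) / sn) (n / 2) /\
  (f TR Tr = Rpower 2 n * g x y z * Rpower ((x + y + z) / sn) (n / 2)
   <-> x = y /\ y = z).
Proof.
  intros Hmono Heq. rewrite g_scaled.
  destruct scale_factor_spec as [Hl Hl2]. destruct root_heron_spec as [Hh Hh2].
  destruct (euclidean_inequality _ _ _ _ _ scaled_euclidean_triangle) as [E1 E2].
  split; [lra |]. split.
  - intros E. assert (E3 : f Rad' r' = g (lam * x) (lam * y) (lam * z)) by lra.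
    apply E2 in E3. destruct E3 as [E3 E4].
    split; apply Rmult_eq_reg_l with lam; lra.
  - intros [Exy Eyz]. specialize (Heq Exy Eyz).
    assert (El : lam = 2 / kap).
    { apply Rsqr_inj; [lra | left; apply Rdiv_lt_0_compat; lra |].
      unfold Rsqr. transitivity (lam ^ 2); [ring |]. rewrite Hl2, Heq.
      field. lra. }
    replace TR with Rad' by (unfold TR, Rad'; rewrite El; field; lra).
    replace Tr with r' by (unfold Tr, r'; rewrite El, Heq; field; lra).
    apply E2. split; f_equal; assumption.
Qed.

Lemma TR_as_quotient : 2 * M ^ 2 / Tr = TR.
Proof.
  destruct root_heron_spec as [Hh _]. destruct product_root_spec as [_ ->].
  unfold Tr, TR. field. lra.
Qed.

Lemma Rad'_as_quotient : 2 * M ^ 2 / r' = Rad'.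
Proof.
  destruct root_heron_spec as [Hh _]. destruct product_root_spec as [_ ->].
  destruct scale_factor_spec as [Hl Hl2].
  transitivity (4 * (x + y + z) / sn * (x * y * z) / (lam * h)).
  - unfold r'. field. lra.
  - rewrite <- Hl2. unfold Rad'. field. lra.
Qed.

Lemma Tr_pos : 0 < Tr.
Proof.
  destruct root_heron_spec as [Hh _]. unfold Tr.
  apply Rdiv_lt_0_compat; [now apply Rmult_lt_0_compat | assumption].
Qed.

Lemma r'_pos : 0 < r'.
Proof.
  destruct root_heron_spec as [Hh _]. destruct scale_factor_spec as [Hl _].
  unfold r'. apply Rdiv_lt_0_compat; [now apply Rmult_lt_0_compat | lra].
Qed.

Lemma r'_sqr : r' ^ 2 = heron x y z / (sn * (x + y + z)).
Proof.
  destruct root_heron_spec as [Hh Hh2]. destruct scale_factor_spec as [Hl Hl2].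
  transitivity (lam ^ 2 * h ^ 2 / (4 * (x + y + z) ^ 2)).
  - unfold r'. field. lra.
  - rewrite Hl2, Hh2. field. lra.
Qed.

Lemma Tr_sqr : Tr ^ 2 = kap ^ 2 * heron x y z / sn ^ 2.
Proof. destruct root_heron_spec as [_ Hh2]. rewrite <- Hh2. unfold Tr. field. lra. Qed.

(** Here [Tr <= r' <= M]; the first inequality amounts to the bound on [sn], the second
    is the Euclidean Euler inequality. *)
Lemma comparison_spherical :
  (forall M : R, 0 < M -> decreasing_upto M (fun x => f (2 * M ^ 2 / x) x)) ->
  kap ^ 2 * (x + y + z) <= sn -> f Rad' r' <= f TR Tr.
Proof.
  intros Hdec Hle. destruct product_root_spec as [HM HM2].
  rewrite <- TR_as_quotient, <- Rad'_as_quotient.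
  apply (Hdec M HM).
  - apply Tr_pos.
  - pose proof Tr_pos. pose proof r'_pos.
    apply le_of_sqr; [lra | lra |]. rewrite Tr_sqr, r'_sqr.
    replace (heron x y z / (sn * (x + y + z)))
      with (sn * (heron x y z / (sn ^ 2 * (x + y + z)))) by (field; lra).
    replace (kap ^ 2 * heron x y z / sn ^ 2)
      with (kap ^ 2 * (x + y + z) * (heron x y z / (sn ^ 2 * (x + y + z))))
      by (field; lra).
    apply Rmult_le_compat_r; [| assumption]. left.
    apply Rdiv_lt_0_compat; [lra |].
    apply Rmult_lt_0_compat; [now apply pow_lt | lra].
  - pose proof r'_pos. apply le_of_sqr; [lra | lra |]. rewrite r'_sqr, HM2.
    replace (x * y * z / sn)
      with (x * y * z * (x + y + z) * / (sn * (x + y + z))) by (field; lra).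
    apply Rmult_le_compat_r; [| now apply heron_le].
    left. apply Rinv_0_lt_compat. (nra || now apply pow_lt).
Qed.

(** Here [r' <= Tr <= M], where the last inequality, an assumption in this lemma, says
    that [2 * Tr <= TR]. *)
Lemma comparison_hyperbolic :
  (forall M : R, 0 < M -> increasing_upto M (fun x => f (2 * M ^ 2 / x) x)) ->
  sn <= kap ^ 2 * (x + y + z) -> kap ^ 2 * heron x y z <= x * y * z * sn ->
  f Rad' r' <= f TR Tr.
Proof.
  intros Hinc Hle Heuler. destruct product_root_spec as [HM HM2].
  rewrite <- TR_as_quotient, <- Rad'_as_quotient.
  apply (Hinc M HM).
  - apply r'_pos.
  - pose proof Tr_pos. pose proof r'_pos.
    apply le_of_sqr; [lra | lra |]. rewrite Tr_sqr, r'_sqr.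
    replace (heron x y z / (sn * (x + y + z)))
      with (sn * (heron x y z / (sn ^ 2 * (x + y + z)))) by (field; lra).
    replace (kap ^ 2 * heron x y z / sn ^ 2)
      with (kap ^ 2 * (x + y + z) * (heron x y z / (sn ^ 2 * (x + y + z))))
      by (field; lra).
    apply Rmult_le_compat_r; [| assumption]. left.
    apply Rdiv_lt_0_compat; [lra |].
    apply Rmult_lt_0_compat; [now apply pow_lt | lra].
  - pose proof Tr_pos. apply le_of_sqr; [lra | lra |]. rewrite Tr_sqr, HM2.
    replace (x * y * z / sn) with (x * y * z * sn * / sn ^ 2) by (field; lra).
    apply Rmult_le_compat_r; [| assumption].
    left. apply Rinv_0_lt_compat. (nra || now apply pow_lt).
Qed.

End Comparison.

(** By Cauchy-Schwarz [Y * Z >= 1 + y * z], so the half perimeter has sine at least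
    [x + y + z + 4 * (x * y * z)], and the claim follows from the Euclidean
    inequality [heron_le]. *)
Lemma hyperbolic_euler (kap k x y z X Y Z : R) :
  0 < x -> 0 < y -> 0 < z -> 0 < X -> 0 < Y -> 0 < Z ->
  X ^ 2 = 1 + x ^ 2 -> Y ^ 2 = 1 + y ^ 2 -> Z ^ 2 = 1 + z ^ 2 ->
  0 < heron x y z ->
  k ^ 2 = kap ^ 2 - 1 -> k ^ 2 * heron x y z = 4 * (x * y * z) ^ 2 ->
  kap ^ 2 * heron x y z <= x * y * z * half_perimeter_sine (-1) x y z X Y Z.
Proof.
  intros Hx Hy Hz HX HY HZ EX EY EZ HH Ek EkH.
  pose proof (heron_le x y z Hx Hy Hz HH) as Hs.
  assert (key : forall y z Y Z, 0 < y -> 0 < z -> 0 < Y -> 0 < Z ->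
            Y ^ 2 = 1 + y ^ 2 -> Z ^ 2 = 1 + z ^ 2 -> 1 + y * z <= Y * Z).
  { clear. intros y z Y Z Hy Hz HY HZ EY EZ.
    apply Rsqr_incr_0; [| nra | nra]. unfold Rsqr.
    replace (Y * Z * (Y * Z)) with (Y ^ 2 * Z ^ 2) by ring. rewrite EY, EZ.
    pose proof (pow2_ge_0 (y - z)). nra. }
  pose proof (key y z Y Z Hy Hz HY HZ EY EZ) as K1.
  pose proof (key x z X Z Hx Hz HX HZ EX EZ) as K2.
  pose proof (key x y X Y Hx Hy HX HY EX EY) as K3.
  assert (Hsn : x + y + z + 4 * (x * y * z) <= half_perimeter_sine (-1) x y z X Y Z).
  { unfold half_perimeter_sine.
    apply (Rmult_le_compat_l x) in K1; [| lra].
    apply (Rmult_le_compat_l y) in K2; [| lra].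
    apply (Rmult_le_compat_l z) in K3; [| lra]. lra. }
  assert (Hxyz : 0 < x * y * z) by (repeat apply Rmult_lt_0_compat; assumption).
  apply (Rmult_le_compat_l (x * y * z)) in Hsn; [| lra].
  replace (kap ^ 2) with (1 + k ^ 2) by lra. lra.
Qed.

(** * Spherical triangles *)

(** Independent vertices are pairwise neither equal nor antipodal: the Gram
    determinant is this product minus a square. *)
Lemma gram_pos_product (a b c : R) :
  0 < gram a b c -> 0 < (1 - b ^ 2) * (1 - c ^ 2).
Proof.
  intros H. pose proof (pow2_ge_0 (a - b * c)).
  replace (gram a b c) with ((1 - b ^ 2) * (1 - c ^ 2) - (a - b * c) ^ 2) in H
    by (unfold gram; ring). lra.
Qed.

Lemma nearest_on_edge_endpoint (c p q m : R) : nearest_on_edge c p q m -> p <= m.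
Proof.
  intros [_ Hmax]. replace p with (1 * p + 0 * q) by ring. apply Hmax; lra.
Qed.

Lemma half_angle_cos (a : R) : cos a = 1 - 2 * 1 * sin (a / 2) ^ 2.
Proof.
  replace a with (2 * (a / 2)) at 1 by field. rewrite cos_2a_sin. ring.
Qed.

Lemma sin_half_sum (a b c : R) :
  sin ((a + b + c) / 2) =
  half_perimeter_sine 1 (sin (a / 2)) (sin (b / 2)) (sin (c / 2))
    (cos (a / 2)) (cos (b / 2)) (cos (c / 2)).
Proof.
  replace ((a + b + c) / 2) with (a / 2 + b / 2 + c / 2) by field.
  rewrite sin_plus, sin_plus, cos_plus. unfold half_perimeter_sine. ring.
Qed.

Lemma cos_sqr (t : R) : cos t ^ 2 = 1 - 1 * sin t ^ 2.
Proof. pose proof (sin2_cos2 t) as H. unfold Rsqr in H. lra. Qed.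

Lemma sphere_form (P : vec3) : sphere P <-> form 1 P P = 1.
Proof. unfold sphere. now rewrite dot_form. Qed.

Lemma sphere_form_bound (P Q : vec3) :
  sphere P -> sphere Q -> -1 <= form 1 P Q <= 1.
Proof.
  unfold sphere. destruct P as [[p1 p2] p3], Q as [[q1 q2] q3]. simpl.
  intros HP HQ.
  pose proof (pow2_ge_0 (p1 - q1)). pose proof (pow2_ge_0 (p2 - q2)).
  pose proof (pow2_ge_0 (p3 - q3)). pose proof (pow2_ge_0 (p1 + q1)).
  pose proof (pow2_ge_0 (p2 + q2)). pose proof (pow2_ge_0 (p3 + q3)). lra.
Qed.

Lemma cos_sphere_dist (P Q : vec3) :
  sphere P -> sphere Q -> cos (sphere_dist P Q) = form 1 P Q.
Proof.
  intros HP HQ. unfold sphere_dist. rewrite dot_form.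
  apply cos_acos. now apply sphere_form_bound.
Qed.

(** The distance is a decreasing function of the inner product, and the points of the
    segment are the normalized nonnegative combinations of its ends. *)
Lemma sphere_touches_nearest (A B I : vec3) (rho : R) :
  sphere A -> sphere B -> sphere I ->
  touches sphere_dist (cone_segment sphere) I rho A B ->
  0 <= rho <= PI /\
  nearest_on_edge (form 1 A B) (form 1 I A) (form 1 I B) (cos rho).
Proof.
  intros HA HB HI [(P & (HP & s & t & Hs & Ht & EP) & Hd) Hmin].
  assert (Hr : 0 <= rho <= PI) by (rewrite <- Hd; apply acos_bound).
  assert (HA' := proj1 (sphere_form A) HA).
  assert (HB' := proj1 (sphere_form B) HB).
  assert (HAB : form 1 A B = 1 * form 1 A B) by ring.
  split; [exact Hr |]. split.
  - exists s, t. repeat split; try assumption.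
    + apply sphere_form in HP.
      rewrite EP, (form_segment 1 _ s t A B HA' HB' HAB) in HP. lra.
    + rewrite <- form_combination2, <- EP, <- Hd. symmetry.
      now apply cos_sphere_dist.
  - intros s' t' Hs' Ht' HN. rewrite <- form_combination2.
    set (Q := add3 (scale3 s' A) (scale3 t' B)).
    assert (HQ : sphere Q).
    { apply sphere_form. unfold Q.
      rewrite (form_segment 1 _ s' t' A B HA' HB' HAB), HN. ring. }
    rewrite <- cos_sphere_dist by assumption.
    apply cos_decr_1; try lra; try apply acos_bound.
    apply Hmin. split; [exact HQ |]. now exists s', t'.
Qed.

Lemma spherical_side (P Q : vec3) :
  sphere P -> sphere Q -> 0 < 1 - form 1 P Q ^ 2 ->
  0 < sphere_dist P Q < PI /\
  0 < sin (sphere_dist P Q / 2) /\ 0 < cos (sphere_dist P Q / 2) /\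
  form 1 P Q = 1 - 2 * 1 * sin (sphere_dist P Q / 2) ^ 2.
Proof.
  intros HP HQ H.
  assert (Hd : 0 < sphere_dist P Q < PI).
  { apply acos_bound_lt. rewrite dot_form. nra. }
  repeat split; try lra.
  - apply sin_gt_0; lra.
  - apply cos_gt_0; lra.
  - rewrite <- half_angle_cos. symmetry. now apply cos_sphere_dist.
Qed.

Lemma spherical_curved_triangle (a b c Rad r : R) :
  spherical_triangle a b c Rad r ->
  (0 < a < PI /\ 0 < b < PI /\ 0 < c < PI) /\
  curved_triangle 1 (cos Rad) (sin Rad)
    (sin (a / 2)) (sin (b / 2)) (sin (c / 2))
    (cos (a / 2)) (cos (b / 2)) (cos (c / 2)) (tan Rad) (tan r).
Proof.
  intros (A & B & C & HA & HB & HC & Hn & -> & -> & -> &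
          (HRad & O & HO & OA & OB & OC) &
          (I & (HI & s & t & u & Hs & Ht & Hu & EI) & TAB & TBC & TCA)).
  destruct (sphere_touches_nearest A B I r HA HB HI TAB) as [Hr NAB].
  destruct (sphere_touches_nearest B C I r HB HC HI TBC) as [_ NBC].
  destruct (sphere_touches_nearest C A I r HC HA HI TCA) as [_ NCA].
  assert (HA' := proj1 (sphere_form A) HA).
  assert (HB' := proj1 (sphere_form B) HB).
  assert (HC' := proj1 (sphere_form C) HC).
  assert (HI' := proj1 (sphere_form I) HI).
  assert (HD : det3 A B C <> 0).
  { apply det3_neq_0; [| exact Hn]. intros E. rewrite E in HA'. simpl in HA'. lra. }
  assert (HG : 0 < gram (form 1 B C) (form 1 C A) (form 1 A B)).
  { rewrite (gram_det3 1 _ _ _ A B C); try assumption; try lra.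
    pose proof (Rsqr_pos_lt _ HD). unfold Rsqr in *. simpl. lra. }
  pose proof (gram_pos_product _ _ _ HG) as P1.
  assert (P2 : 0 < (1 - form 1 A B ^ 2) * (1 - form 1 B C ^ 2)).
  { apply gram_pos_product with (form 1 C A). unfold gram in *. lra. }
  assert (Hpos : forall p q, 0 <= p -> 0 < p * q -> 0 < p).
  { intros p q [Hp | <-] Hpq; [exact Hp | rewrite Rmult_0_l in Hpq; lra]. }
  assert (Hsqr : forall P Q, sphere P -> sphere Q -> 0 <= 1 - form 1 P Q ^ 2).
  { intros P Q HP HQ. pose proof (sphere_form_bound P Q HP HQ). nra. }
  destruct (spherical_side B C HB HC) as (La & Hx & HX & Ea).
  { apply Hpos with (1 - form 1 A B ^ 2); [now apply Hsqr | lra]. }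
  destruct (spherical_side C A HC HA) as (Lb & Hy & HY & Eb).
  { apply Hpos with (1 - form 1 A B ^ 2); [now apply Hsqr | lra]. }
  destruct (spherical_side A B HA HB) as (Lc & Hz & HZ & Ec).
  { apply Hpos with (1 - form 1 C A ^ 2); [now apply Hsqr | lra]. }
  split; [tauto |].
  assert (HRad0 : 0 <= Rad) by (rewrite <- OA; apply acos_bound).
  assert (Ecenter : forall V, sphere V -> sphere_dist O V = Rad ->
            form 1 O V = 1 * cos Rad).
  { intros V HV HOV. rewrite <- HOV, cos_sphere_dist by assumption. ring. }
  (* An incenter at distance at least [PI / 2] from the edges would have nonpositive
     inner product with the vertices, hence with itself. *)
  assert (Hcosr : 0 < cos r).
  { apply Rnot_le_lt. intros Hneg.
    pose proof (nearest_on_edge_endpoint _ _ _ _ NAB).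
    pose proof (nearest_on_edge_endpoint _ _ _ _ NBC).
    pose proof (nearest_on_edge_endpoint _ _ _ _ NCA).
    assert (E : form 1 I I = s * form 1 I A + t * form 1 I B + u * form 1 I C).
    { rewrite EI at 1. rewrite form_combination3, (form_sym 1 A I),
        (form_sym 1 B I), (form_sym 1 C I). reflexivity. }
    nra. }
  rewrite Ec in NAB. rewrite Ea in NBC. rewrite Eb in NCA.
  pose proof PI_RGT_0.
  apply curved_radii with (m := cos r) (A := A) (B := B) (C := C) (O := O) (I := I)
    (s := s) (t := t) (u := u); try assumption; try (now apply Ecenter);
    try apply cos_sqr; try lra.
  - now apply sphere_form.
  - apply cos_gt_0; lra.
  - apply sin_ge_0; lra.
  - rewrite cos_sqr. ring.
  - apply sin_ge_0; lra.
  - rewrite cos_sqr. ring.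
Qed.

(** * Hyperbolic triangles *)

Lemma cosh_sqr (t : R) : cosh t ^ 2 = 1 - -1 * sinh t ^ 2.
Proof.
  unfold cosh, sinh.
  assert (H : exp t * exp (- t) = 1)
    by (rewrite <- exp_plus, Rplus_opp_r; apply exp_0).
  nra.
Qed.

Lemma cosh_pos (t : R) : 0 < cosh t.
Proof.
  unfold cosh. pose proof (exp_pos t). pose proof (exp_pos (- t)). lra.
Qed.

Lemma sinh_pos (t : R) : 0 < t -> 0 < sinh t.
Proof. intros H. rewrite <- sinh_0. now apply sinh_lt. Qed.

Lemma half_angle_cosh (a : R) : cosh a = 1 - 2 * -1 * sinh (a / 2) ^ 2.
Proof.
  unfold cosh, sinh.
  assert (H : exp (a / 2) * exp (- (a / 2)) = 1)
    by (rewrite <- exp_plus, Rplus_opp_r; apply exp_0).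
  replace (exp a) with (exp (a / 2) * exp (a / 2))
    by (rewrite <- exp_plus; f_equal; field).
  replace (exp (- a)) with (exp (- (a / 2)) * exp (- (a / 2)))
    by (rewrite <- exp_plus; f_equal; field).
  nra.
Qed.

Lemma sinh_half_sum (a b c : R) :
  sinh ((a + b + c) / 2) =
  half_perimeter_sine (-1) (sinh (a / 2)) (sinh (b / 2)) (sinh (c / 2))
    (cosh (a / 2)) (cosh (b / 2)) (cosh (c / 2)).
Proof.
  unfold half_perimeter_sine, sinh, cosh.
  replace ((a + b + c) / 2) with (a / 2 + b / 2 + c / 2) by field.
  replace (- (a / 2 + b / 2 + c / 2)) with (- (a / 2) + - (b / 2) + - (c / 2))
    by ring.
  rewrite !exp_plus. field.
Qed.

Lemma cosh_incr (p q : R) : 0 <= p -> p <= q -> cosh p <= cosh q.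
Proof.
  intros Hp Hpq.
  assert (0 <= sinh p).
  { destruct Hp as [Hp | <-]; [left; now apply sinh_pos | rewrite sinh_0; lra]. }
  assert (sinh p <= sinh q).
  { destruct Hpq as [Hpq | ->]; [left; now apply sinh_lt | lra]. }
  pose proof (cosh_pos p). pose proof (cosh_pos q).
  pose proof (cosh_sqr p). pose proof (cosh_sqr q).
  apply Rsqr_incr_0; unfold Rsqr; nra.
Qed.

Lemma arcosh_nonneg (v : R) : 1 <= v -> 0 <= arcosh v.
Proof.
  intros Hv. unfold arcosh. pose proof (sqrt_pos (v ^ 2 - 1)).
  destruct (Rle_lt_or_eq_dec 1 (v + sqrt (v ^ 2 - 1))) as [H1 | <-]; [lra | |].
  - rewrite <- ln_1. left. apply ln_increasing; lra.
  - rewrite ln_1. lra.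
Qed.

Lemma cosh_arcosh (v : R) : 1 <= v -> cosh (arcosh v) = v.
Proof.
  intros Hv. unfold arcosh, cosh. pose proof (sqrt_pos (v ^ 2 - 1)).
  assert (Hw : sqrt (v ^ 2 - 1) ^ 2 = v ^ 2 - 1) by (apply pow2_sqrt; nra).
  set (w := sqrt (v ^ 2 - 1)) in *.
  rewrite exp_Ropp, exp_ln by lra.
  replace (/ (v + w)) with (v - w); [field |].
  apply Rmult_eq_reg_r with (v + w); [| lra].
  rewrite Rinv_l by lra. lra.
Qed.

Lemma hyperboloid_form (P : vec3) : hyperboloid P -> form (-1) P P = -1.
Proof. intros [H _]. now rewrite <- lorentz_form. Qed.

(** The reversed Cauchy-Schwarz inequality for timelike vectors in the same half of the
    light cone. *)
Lemma hyperboloid_form_bound (P Q : vec3) :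
  hyperboloid P -> hyperboloid Q -> 1 <= - form (-1) P Q.
Proof.
  unfold hyperboloid. destruct P as [[p1 p2] p3], Q as [[q1 q2] q3]. simpl.
  intros [HP Hp] [HQ Hq].
  pose proof (pow2_ge_0 p1). pose proof (pow2_ge_0 p2).
  pose proof (pow2_ge_0 q1). pose proof (pow2_ge_0 q2).
  assert (Hp1 : 1 <= p3) by nra. assert (Hq1 : 1 <= q3) by nra.
  assert (Hle : p1 * q1 + p2 * q2 <= p3 * q3 - 1).
  { apply Rle_trans with (Rabs (p1 * q1 + p2 * q2)); [apply Rle_abs |].
    apply Rsqr_incr_0; [| apply Rabs_pos | nra].
    rewrite <- Rsqr_abs. unfold Rsqr.
    replace ((p3 * q3 - 1) * (p3 * q3 - 1))
      with ((p3 * p3 - 1) * (q3 * q3 - 1) + (p3 - q3) ^ 2) by ring.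
    replace (p3 * p3 - 1) with (p1 * p1 + p2 * p2) by lra.
    replace (q3 * q3 - 1) with (q1 * q1 + q2 * q2) by lra.
    pose proof (pow2_ge_0 (p3 - q3)). pose proof (pow2_ge_0 (p1 * q2 - p2 * q1)).
    nra. }
  lra.
Qed.

Lemma cosh_hyperboloid_dist (P Q : vec3) :
  hyperboloid P -> hyperboloid Q -> cosh (hyperboloid_dist P Q) = - form (-1) P Q.
Proof.
  intros HP HQ. unfold hyperboloid_dist. rewrite lorentz_form.
  apply cosh_arcosh. now apply hyperboloid_form_bound.
Qed.

Lemma hyperboloid_dist_nonneg (P Q : vec3) :
  hyperboloid P -> hyperboloid Q -> 0 <= hyperboloid_dist P Q.
Proof.
  intros HP HQ. apply arcosh_nonneg. rewrite lorentz_form.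
  now apply hyperboloid_form_bound.
Qed.

Lemma hyperboloid_combination (A B : vec3) (s t : R) :
  hyperboloid A -> hyperboloid B -> 0 <= s -> 0 <= t ->
  s ^ 2 + t ^ 2 + 2 * - form (-1) A B * s * t = 1 ->
  hyperboloid (add3 (scale3 s A) (scale3 t B)).
Proof.
  intros HA HB Hs Ht HN. split.
  - rewrite lorentz_form, (form_segment (-1) (- form (-1) A B) s t A B).
    + rewrite HN. ring.
    + now apply hyperboloid_form.
    + now apply hyperboloid_form.
    + ring.
  - destruct HA as [_ HA], HB as [_ HB].
    assert (Hst : 0 < s \/ 0 < t).
    { destruct Hs as [Hs | <-]; [now left |].
      destruct Ht as [Ht | <-]; [now right | exfalso; lra]. }
    destruct A as [[a1 a2] a3], B as [[b1 b2] b3]. simpl in *. nra.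
Qed.

Lemma hyperboloid_touches_nearest (A B I : vec3) (rho : R) :
  hyperboloid A -> hyperboloid B -> hyperboloid I ->
  touches hyperboloid_dist (cone_segment hyperboloid) I rho A B ->
  0 <= rho /\
  nearest_on_edge (- form (-1) A B) (form (-1) I A) (form (-1) I B) (- cosh rho).
Proof.
  intros HA HB HI [(P & (HP & s & t & Hs & Ht & EP) & Hd) Hmin].
  assert (Hr : 0 <= rho) by (rewrite <- Hd; now apply hyperboloid_dist_nonneg).
  assert (HAB : form (-1) A B = -1 * - form (-1) A B) by ring.
  split; [exact Hr |]. split.
  - exists s, t. repeat split; try assumption.
    + apply hyperboloid_form in HP.
      rewrite EP, (form_segment (-1) _ s t A B (hyperboloid_form A HA)
                     (hyperboloid_form B HB) HAB) in HP. lra.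
    + rewrite <- form_combination2, <- EP, <- Hd.
      rewrite cosh_hyperboloid_dist by assumption. ring.
  - intros s' t' Hs' Ht' HN. rewrite <- form_combination2.
    set (Q := add3 (scale3 s' A) (scale3 t' B)).
    assert (HQ : hyperboloid Q) by now apply hyperboloid_combination.
    assert (Hle : cosh rho <= cosh (hyperboloid_dist I Q)).
    { apply cosh_incr; [exact Hr |]. apply Hmin.
      split; [exact HQ |]. now exists s', t'. }
    rewrite cosh_hyperboloid_dist in Hle by assumption. lra.
Qed.

Lemma hyperbolic_side (P Q : vec3) :
  hyperboloid P -> hyperboloid Q -> 1 - form (-1) P Q ^ 2 <> 0 ->
  0 < sinh (hyperboloid_dist P Q / 2) /\
  form (-1) P Q = -1 * (1 - 2 * -1 * sinh (hyperboloid_dist P Q / 2) ^ 2).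
Proof.
  intros HP HQ H.
  assert (E : form (-1) P Q = -1 * cosh (hyperboloid_dist P Q))
    by (rewrite cosh_hyperboloid_dist by assumption; ring).
  rewrite half_angle_cosh in E. split; [| exact E].
  destruct (hyperboloid_dist_nonneg P Q HP HQ) as [Hd | Hd].
  - apply sinh_pos. lra.
  - exfalso. apply H. rewrite E, <- Hd.
    replace (0 / 2) with 0 by field. rewrite sinh_0. ring.
Qed.

Lemma hyperbolic_curved_triangle (a b c Rad r : R) :
  hyperbolic_triangle a b c Rad r ->
  curved_triangle (-1) (cosh Rad) (sinh Rad)
    (sinh (a / 2)) (sinh (b / 2)) (sinh (c / 2))
    (cosh (a / 2)) (cosh (b / 2)) (cosh (c / 2)) (tanh Rad) (tanh r).
Proof.
  intros (A & B & C & HA & HB & HC & Hn & -> & -> & -> &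
          (O & HO & OA & OB & OC) &
          (I & (HI & s & t & u & Hs & Ht & Hu & EI) & TAB & TBC & TCA)).
  destruct (hyperboloid_touches_nearest A B I r HA HB HI TAB) as [Hr NAB].
  destruct (hyperboloid_touches_nearest B C I r HB HC HI TBC) as [_ NBC].
  destruct (hyperboloid_touches_nearest C A I r HC HA HI TCA) as [_ NCA].
  assert (HA' := hyperboloid_form A HA). assert (HB' := hyperboloid_form B HB).
  assert (HC' := hyperboloid_form C HC).
  assert (HD : det3 A B C <> 0).
  { apply det3_neq_0; [| exact Hn]. intros E. rewrite E in HA'. simpl in HA'. lra. }
  assert (HG : 0 < gram (- form (-1) B C) (- form (-1) C A) (- form (-1) A B)).
  { rewrite (gram_det3 (-1) _ _ _ A B C); try assumption; try lra.
    pose proof (Rsqr_pos_lt _ HD). unfold Rsqr in *. simpl. lra. }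
  pose proof (gram_pos_product _ _ _ HG) as P1.
  assert (P2 : 0 < (1 - (- form (-1) A B) ^ 2) * (1 - (- form (-1) B C) ^ 2)).
  { apply gram_pos_product with (- form (-1) C A). unfold gram in *. lra. }
  assert (Hne : forall p q, 0 < p * q -> p <> 0).
  { intros p q Hpq ->. rewrite Rmult_0_l in Hpq. lra. }
  destruct (hyperbolic_side B C HB HC) as (Hx & Ea).
  { apply Hne with (1 - form (-1) A B ^ 2). lra. }
  destruct (hyperbolic_side C A HC HA) as (Hy & Eb).
  { apply Hne with (1 - form (-1) A B ^ 2). lra. }
  destruct (hyperbolic_side A B HA HB) as (Hz & Ec).
  { apply Hne with (1 - form (-1) C A ^ 2). lra. }
  assert (HRad0 : 0 <= Rad) by (rewrite <- OA; now apply hyperboloid_dist_nonneg).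
  assert (Ecenter : forall V, hyperboloid V -> hyperboloid_dist O V = Rad ->
            form (-1) O V = -1 * cosh Rad).
  { intros V HV HOV. rewrite <- HOV, cosh_hyperboloid_dist by assumption. ring. }
  assert (Hsinh : forall v, 0 <= v -> 0 <= sinh v).
  { intros v [Hv | <-]; [left; now apply sinh_pos | rewrite sinh_0; lra]. }
  rewrite Ec in NAB. rewrite Ea in NBC. rewrite Eb in NCA.
  assert (Hopp : forall w, - (-1 * w) = w) by (intros; ring).
  rewrite Hopp in NAB, NBC, NCA.
  unfold tanh.
  apply curved_radii with (m := - cosh r) (A := A) (B := B) (C := C) (O := O)
    (I := I) (s := s) (t := t) (u := u); try assumption;
    try (now apply Ecenter); try apply cosh_sqr; try apply cosh_pos;
    try (now apply Hsinh); try (now apply hyperboloid_form); try lra.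
  - rewrite cosh_sqr. ring.
  - replace ((- cosh r) ^ 2) with (cosh r ^ 2) by ring. rewrite cosh_sqr. ring.
Qed.

(** * The transfer theorem *)

Lemma sin_half_inj (a b : R) :
  0 < a < PI -> 0 < b < PI -> sin (a / 2) = sin (b / 2) -> a = b.
Proof.
  intros Ha Hb E. destruct (Rtotal_order a b) as [H | [H | H]]; [| exact H |].
  - assert (sin (a / 2) < sin (b / 2)) by (apply sin_increasing_1; lra). lra.
  - assert (sin (b / 2) < sin (a / 2)) by (apply sin_increasing_1; lra). lra.
Qed.

Lemma sinh_half_inj (a b : R) : sinh (a / 2) = sinh (b / 2) -> a = b.
Proof.
  intros E. apply (f_equal arcsinh) in E. rewrite !arcsinh_sinh in E. lra.
Qed.

Lemma curved_triangle_equilateral (e kap k x X TR Tr : R) :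
  e = 1 \/ e = -1 -> curved_triangle e kap k x x x X X X TR Tr ->
  half_perimeter_sine e x x x X X X = kap ^ 2 * (x + x + x).
Proof.
  intros He [(Hx & _) _ (EX & _) _ Ek _ EkH _ _ _].
  now apply half_perimeter_sine_equilateral with k.
Qed.

Theorem theorem3p2 :
  forall (n : R) (f : R -> R -> R) (g : R -> R -> R -> R),
    homogeneous2 n f ->
    homogeneous3 n g ->
    (forall a b c Rad r : R, euclidean_triangle a b c Rad r ->
       f Rad r >= g a b c /\
       (f Rad r = g a b c <-> a = b /\ b = c)) ->
    ((forall M : R, 0 < M -> decreasing_upto M (fun x => f (2 * M ^ 2 / x) x)) ->
     forall a b c Rad r : R, spherical_triangle a b c Rad r ->
       let rhs :=
         Rpower 2 n * g (sin (a / 2)) (sin (b / 2)) (sin (c / 2)) *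
         Rpower ((sin (a / 2) + sin (b / 2) + sin (c / 2)) /
                 sin ((a + b + c) / 2)) (n / 2) in
       f (tan Rad) (tan r) >= rhs /\
       (f (tan Rad) (tan r) = rhs <-> a = b /\ b = c)) /\
    ((forall M : R, 0 < M -> increasing_upto M (fun x => f (2 * M ^ 2 / x) x)) ->
     forall a b c Rad r : R, hyperbolic_triangle a b c Rad r ->
       let rhs :=
         Rpower 2 n * g (sinh (a / 2)) (sinh (b / 2)) (sinh (c / 2)) *
         Rpower ((sinh (a / 2) + sinh (b / 2) + sinh (c / 2)) /
                 sinh ((a + b + c) / 2)) (n / 2) in
       f (tanh Rad) (tanh r) >= rhs /\
       (f (tanh Rad) (tanh r) = rhs <-> a = b /\ b = c)).
Proof.
  intros n f g _ Hg Heuc. split; intros Hmono a b c Rad r T.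
  - destruct (spherical_curved_triangle a b c Rad r T) as [(La & Lb & Lc) CT].
    assert (Heq : sin (a / 2) = sin (b / 2) -> sin (b / 2) = sin (c / 2) ->
      half_perimeter_sine 1 (sin (a / 2)) (sin (b / 2)) (sin (c / 2))
        (cos (a / 2)) (cos (b / 2)) (cos (c / 2))
      = cos Rad ^ 2 * (sin (a / 2) + sin (b / 2) + sin (c / 2))).
    { intros E1 E2. apply sin_half_inj in E1, E2; try assumption. subst b c.
      eapply curved_triangle_equilateral; [now left | exact CT]. }
    intros rhs. unfold rhs. rewrite sin_half_sum.
    destruct CT as [(Hx & Hy & Hz) (HX & HY & HZ) (EX & EY & EZ) Hkap Ek HH EkH
                    Hsn ER Er].
    rewrite ER, Er.
    edestruct (curved_from_euclidean n f g Hg Heuc) as [C1 C2];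
      [exact Hx | exact Hy | exact Hz | exact HH | exact Hkap | exact Hsn | | |].
    + apply comparison_spherical; try assumption.
      pose proof (half_perimeter_sine_comparison 1 _ _ _ _ _ _ _ _
        (or_introl eq_refl) Hx Hy Hz HX HY HZ EX EY EZ Ek EkH). lra.
    + exact Heq.
    + split; [exact C1 |]. rewrite C2. split.
      * intros [E1 E2]. split; now apply sin_half_inj.
      * now intros [-> ->].
  - pose proof (hyperbolic_curved_triangle a b c Rad r T) as CT.
    assert (Heq : sinh (a / 2) = sinh (b / 2) -> sinh (b / 2) = sinh (c / 2) ->
      half_perimeter_sine (-1) (sinh (a / 2)) (sinh (b / 2)) (sinh (c / 2))
        (cosh (a / 2)) (cosh (b / 2)) (cosh (c / 2))
      = cosh Rad ^ 2 * (sinh (a / 2) + sinh (b / 2) + sinh (c / 2))).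
    { intros E1 E2. apply sinh_half_inj in E1, E2. subst b c.
      eapply curved_triangle_equilateral; [now right | exact CT]. }
    intros rhs. unfold rhs. rewrite sinh_half_sum.
    destruct CT as [(Hx & Hy & Hz) (HX & HY & HZ) (EX & EY & EZ) Hkap Ek HH EkH
                    Hsn ER Er].
    rewrite ER, Er.
    edestruct (curved_from_euclidean n f g Hg Heuc) as [C1 C2];
      [exact Hx | exact Hy | exact Hz | exact HH | exact Hkap | exact Hsn | | |].
    + apply comparison_hyperbolic; try assumption.
      * pose proof (half_perimeter_sine_comparison (-1) _ _ _ _ _ _ _ _
          (or_intror eq_refl) Hx Hy Hz HX HY HZ EX EY EZ Ek EkH). lra.
      * apply hyperbolic_euler with (sinh Rad); try assumption; lra.
    + exact Heq.
    + split; [exact C1 |]. rewrite C2. split.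
      * intros [E1 E2]. split; now apply sinh_half_inj.
      * now intros [-> ->].
Qed.
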